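(* Let $R>0$, $M\ge0$, $\sigma>0$. Let $\rho_0\in H^3_{ep}(\tilde X)\cap\mathcal P_e(\tilde X)$ and $\rho_r\in H^2_{ep}(\tilde X)\cap\mathcal P_e(\tilde X)$, and let $\rho\in C^1(0,\infty;C^2_{ep}(\tilde X))$ with $\rho(t):=\rho(\cdot,t)\in\mathcal P_e(\tilde X)$ be the solution of $$\rho_t=(\rho\,G_\rho)_x+\tfrac{\sigma^2}{2}\rho_{xx}\ \text{ for } t>0,\qquad \rho(x+2,t)=\rho(x,t),\qquad \rho(\cdot,0)=\rho_0,$$ where $G_\rho=w\star(\rho+M\rho_r)$. The equation $$\sigma_s^2=\frac{4R(3+M)}{\pi}+\frac{4R^2}{\pi\sqrt3}\exp\Big(\frac{8R(1+M)}{\sigma_s^2}\Big)$$ has a unique solution $\sigma_s>0$, and if $\sigma>\sigma_s$, then $\rho(t)$ converges exponentially in $L^2$ as $t\to\infty$ to a stationary state $\rho^s\in C^2_{ep}(\tilde X)\cap\mathcal P_e(\tilde X)$, i.e. to a solution $\rho^s$ of $\tfrac{\sigma^2}{2}\rho^s_{xx}+(\rho^sG_{\rho^s})_x=0$: there are constants $\beta,\lambda>0$ such that $\|\rho(t)-\rho^s\|_{L^2}\le\beta e^{-\lambda t}$ for all $t\ge0$.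
   Context: $X=[0,1]$, $\tilde X=[-1,1]$. Functions on $\tilde X$ in the periodic spaces below are identified with their $2$-periodic extensions to $\mathbb R$. The function $w:\mathbb R\to\mathbb R$ is $w(\xi)=\xi$ if $|\xi|\le R$ and $w(\xi)=0$ if $|\xi|>R$, and $(w\star f)(x)=\int_{\mathbb R}w(x-y)f(y)\,dy=\int_{x-R}^{x+R}(x-y)f(y)\,dy$ for $2$-periodic $f$ (convolution in $x$). $\mathcal P_e(\tilde X)$ is the set of functions $\rho:\tilde X\to[0,\infty)$ with $\int_X\rho(x)\,dx=1$ and $\rho(-x)=\rho(x)$. $H^k=W^{k,2}$; $H^k_{per}(\tilde X)$ is the space of $2$-periodic functions in $H^k_{loc}(\mathbb R)$, and $H^k_{ep}(\tilde X)$ is its subspace of even functions. $C^2_{ep}(\tilde X)$ is the space of even, $2$-periodic, twice continuously differentiable functions on $\mathbb R$. $C^1(0,\infty;C^2_{ep}(\tilde X))$ denotes the continuously differentiable maps from $(0,\infty)$ to $C^2_{ep}(\tilde X)$. The PDE holds pointwise for $t>0$; the initial condition is understood in the sense that $t\mapsto\rho(\cdot,t)$ is continuous from $[0,\infty)$ to $L^2(\tilde X)$ with value $\rho_0$ at $t=0$. Under the stated hypotheses on $\rho_0,\rho_r$ such a solution exists and is unique. The $L^2$ norm is over $\tilde X$. *)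

(* Defs.v *)
From HB Require Import structures.
From mathcomp Require Import all_boot all_order all_algebra.
From mathcomp Require Import all_classical all_reals all_analysis.

Set Implicit Arguments.
Unset Strict Implicit.
Unset Printing Implicit Defensive.

Import Order.TTheory GRing.Theory Num.Theory.
Import numFieldNormedType.Exports.

Local Open Scope classical_set_scope.
Local Open Scope ring_scope.

(* Functions on [-1, 1] in the periodic spaces are represented by their
   2-periodic extensions R -> R; elements of H^k are represented by an
   everywhere even and 2-periodic member of their a.e. class. *)
Section Defs.
Context {R : realType}.
Implicit Types (f g phi rho : R -> R) (u : R -> R -> R).

Local Notation mu := (@lebesgue_measure R).

Definition even_periodic f := (forall x, f (- x) = f x) /\ periodic f 2.

Definition test_function phi :=
  (forall n x, derivable (derive1n n phi) x 1) /\
  (exists2 K : set R, compact K & forall x, ~ K x -> phi x = 0).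

Definition L2loc f :=
  measurable_fun [set: R] f /\
  locally_integrable [set: R] (fun x => f x ^+ 2).

Definition weak_derivative (j : nat) f g :=
  forall phi, test_function phi ->
    \int[mu]_x (f x * derive1n j phi x) = (-1) ^+ j * \int[mu]_x (g x * phi x).

Definition Hloc (k : nat) f :=
  L2loc f /\
  forall j, (j <= k)%N -> exists2 g, L2loc g & weak_derivative j f g.

Definition Hep (k : nat) f := Hloc k f /\ even_periodic f.

Definition Pe f :=
  [/\ forall x, -1 <= x <= 1 -> 0 <= f x,
      forall x, -1 <= x <= 1 -> f (- x) = f x,
      mu.-integrable `[0, 1] (EFin \o f) &
      \int[mu]_(x in `[0, 1]) f x = 1].

Definition C2ep f :=
  [/\ even_periodic f,
      forall x, derivable f x 1,
      forall x, derivable (derive1 f) x 1 &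
      continuous (derive1n 2 f)].

(* Extended-real valued, so that an infinite norm is never read as 0. *)
Definition C2norm f : \bar R :=
  (\sum_(i < 3) ereal_sup [set `|derive1n i f x|%:E | x in [set: R]])%E.

Definition L2norm f : \bar R := 'N[mu]_2%:E[(EFin \o f) \_ (`[-1, 1] : set R)].

(* u t x is the value at time t and position x; u \in C^1(0, oo; C^2_ep) as a
   map into the Banach space C^2_ep, with Frechet derivative du. *)
Definition C1_C2ep u :=
  (forall t, 0 < t -> C2ep (u t)) /\
  exists du : R -> R -> R, forall t, 0 < t ->
    [/\ C2ep (du t),
        C2norm (fun x => h^-1 * (u (t + h) x - u t x) - du t x)
          @[h --> 0^'] --> 0%E &
        C2norm (fun x => du s x - du t x) @[s --> t] --> 0%E].

Definition L2_continuous u :=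
  forall t, 0 <= t ->
    L2norm (fun x => u s x - u t x)
      @[s --> within `[0, +oo[ (nbhs t)] --> 0%E.

Definition kernel_w (r xi : R) : R := if `|xi| <= r then xi else 0.

Definition conv_w (r : R) f (x : R) : R :=
  \int[mu]_y (kernel_w r (x - y) * f y).

Definition drift (r M : R) (rho_r rho : R -> R) : R -> R :=
  conv_w r (fun y => rho y + M * rho_r y).

Definition flux (r M : R) (rho_r rho : R -> R) (x : R) : R :=
  rho x * drift r M rho_r rho x.

Definition solution (r M sigma : R) (rho_0 rho_r : R -> R) u :=
  [/\ C1_C2ep u,
      forall t, 0 <= t -> Pe (u t),
      forall t x, 0 < t ->
        derivable (flux r M rho_r (u t)) x 1 /\
        derive1 (fun s => u s x) t =
          derive1 (flux r M rho_r (u t)) x + sigma ^+ 2 / 2 * derive1n 2 (u t) x,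
      forall x, u 0 x = rho_0 x &
      L2_continuous u].

Definition stationary (r M sigma : R) (rho_r rho_s : R -> R) :=
  forall x,
    derivable (flux r M rho_r rho_s) x 1 /\
    sigma ^+ 2 / 2 * derive1n 2 rho_s x + derive1 (flux r M rho_r rho_s) x = 0.

Definition threshold (r M s : R) :=
  0 < s /\
  s ^+ 2 = 4 * r * (3 + M) / pi +
    4 * r ^+ 2 / (pi * Num.sqrt 3) * expR (8 * r * (1 + M) / s ^+ 2).

End Defs.

(* Main.v *)
Require Import Defs.
From HB Require Import structures.
From mathcomp Require Import all_boot all_order all_algebra.
From mathcomp Require Import all_classical all_reals all_analysis.
From mathcomp Require Import measurable_realfun.
From mathcomp Require Import ring lra.

Set Implicit Arguments.
Unset Strict Implicit.
Unset Printing Implicit Defensive.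

Import Order.TTheory GRing.Theory Num.Theory.
Import numFieldNormedType.Exports.

Local Open Scope classical_set_scope.
Local Open Scope ring_scope.

(** Write [p] for a stationary density, [tau] for [sigma ^ 2], [G_f] for the
    drift generated by a density [f], and [psi = rho t - p].  All functions are
    even and 2-periodic, so that everything happens on [0, 1], where [psi] has
    mean zero and where the fluxes vanish at both ends.

    Existence of [p].  A density is stationary exactly when it is the Gibbs
    density [exp (- (2 / tau) * primitive of G) / Z] of its own drift [G].  If
    two drifts differ by at most [g], their potentials differ, up to a constant,
    by at most [g / tau]; hence the Gibbs densities are at distance at most
    [g / tau] in [L^1 (0, 1)] ([gibbs_contraction]).  The periodisation of the
    kernel [w] is bounded by [r], so the drift depends on the density with
    constant [2 r] ([conv_w_bound]).  The map on drifts is thus a contraction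
    with ratio [2 r / tau] in the uniform norm; above the threshold this ratio is
    smaller than one and Picard iteration converges ([stationary_drift]).

    Decay.  Since the total flux of [p] vanishes, that of [rho t] equals
    [psi G_rho + p (w * psi) + (tau / 2) psi_x].  Testing the equation with [psi]
    gives the dissipation [(tau / 2) |psi_x|^2] and two terms to absorb.  The
    first is controlled by the bound [2 r (1 + M)] on drifts, the second by
    [p <= exp (4 r (1 + M) / tau)], which comes from the Gibbs form, together with
    the Cauchy-Schwarz bound of [w * psi].  With the sharp Neumann inequality
    [pi |psi| <= |psi_x|] ([neumann_poincare]) both are absorbed under
    the threshold condition ([dissipation], [dissipation_rate_gt0]), and
    Gronwall's inequality gives the exponential rate.  The initial time is
    reached because the energy stays bounded there by [L^2] continuity.

    Regularity of [p].  The drift [G] of [p] has to be continuously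
    differentiable, whereas [rho_r] is a pointwise representative of its class and
    may be discontinuous.  The regularity is read off the solution itself.  As
    the total dissipation is finite, at some time [psi_x] is so small in [L^2]
    that the solution is positive everywhere ([exists_positive_time]).  At that
    time its drift is the quotient of its flux, which is continuously
    differentiable because of the equation, by the solution; and [G] differs from
    that drift by the convolution of [w] with a continuous function
    ([stationary_drift_C1]). *)

(** * Integrals over segments *)

Section SegmentIntegral.
Context {R : realType}.
Local Notation mu := (@lebesgue_measure R).
Implicit Types (f g h : R -> R) (a b c x : R).

Definition sint a b f : R := \int[mu]_(x in `[a, b]) f x.

(** This class contains both the continuous functions and the reference density,
    which may be discontinuous. *)
Definition locint f := forall a b, mu.-integrable `[a, b] (EFin \o f).

Lemma sintE a b f : sint a b f = \int[mu]_(x in `[a, b]) f x.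
Proof. by []. Qed.

Lemma continuous_locint f : continuous f -> locint f.
Proof.
move=> cf a b; apply: continuous_compact_integrable; first exact: segment_compact.
exact: continuous_subspaceT.
Qed.

Lemma locint_measurable f : locint f -> measurable_fun [set: R] f.
Proof.
move=> lf.
have cov : [set: R] = \bigcup_i `[- i%:R, i%:R]%classic.
  apply/seteqP; split => // x _; exists (Num.truncn `|x|).+1 => //=.
  have /ltW := truncnS_gt `|x|.
  by rewrite in_itv/= -ler_norml.
rewrite cov; apply/measurable_fun_bigcup => // i.
by have /integrableP[/measurable_EFinP] := lf (- i%:R) i%:R.
Qed.

Lemma locintD f g : locint f -> locint g -> locint (fun x => f x + g x).
Proof. by move=> lf lg a b; exact: (integrableD _ (lf a b) (lg a b)). Qed.

Lemma locintB f g : locint f -> locint g -> locint (fun x => f x - g x).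
Proof. by move=> lf lg a b; exact: (integrableB _ (lf a b) (lg a b)). Qed.

Lemma locintZ k f : locint f -> locint (fun x => k * f x).
Proof. by move=> lf a b; exact: (integrableZl _ k (lf a b)). Qed.

Lemma locint_mulcont g f : continuous g -> locint f ->
  locint (fun x => g x * f x).
Proof.
move=> cg lf a b.
apply: (@integrableMr _ _ _ mu `[a, b] _ g (EFin \o f)) => //.
- apply: measurable_funTS; exact: continuous_measurable_fun.
- have : compact (g @` `[a, b]).
    apply: continuous_compact; first exact: continuous_subspaceT.
    exact: segment_compact.
  move=> /compact_bounded[M [Mr HM]]; exists M; split => // x Mx y /= yab.
  by apply: (HM x Mx); exists y.
Qed.

Lemma sintD a b f g : locint f -> locint g ->
  sint a b (fun x => f x + g x) = sint a b f + sint a b g.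
Proof. by move=> lf lg; rewrite /sint RintegralD. Qed.

Lemma sintB a b f g : locint f -> locint g ->
  sint a b (fun x => f x - g x) = sint a b f - sint a b g.
Proof. by move=> lf lg; rewrite /sint RintegralB. Qed.

Lemma sintZ a b k f : locint f -> sint a b (fun x => k * f x) = k * sint a b f.
Proof. by move=> lf; rewrite /sint RintegralZl. Qed.

Lemma sint_cst a b k : a <= b -> sint a b (fun=> k) = k * (b - a).
Proof.
move=> ab; rewrite /sint Rintegral_cst//= lebesgue_measure_itv/= lte_fin.
by case: ltgtP ab => //= -> _; rewrite subrr.
Qed.

Lemma eq_sint a b f g : (forall x, a <= x <= b -> f x = g x) ->
  sint a b f = sint a b g.
Proof. by move=> fg; apply: eq_Rintegral => x; rewrite inE/= in_itv/=; exact: fg. Qed.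

Lemma congr_sint a b a' b' f : a = a' -> b = b' -> sint a b f = sint a' b' f.
Proof. by move=> -> ->. Qed.

Lemma le_sint a b f g : locint f -> locint g ->
  (forall x, a <= x <= b -> f x <= g x) -> sint a b f <= sint a b g.
Proof.
by move=> lf lg fg; apply: le_Rintegral => // x /=; rewrite in_itv/=; exact: fg.
Qed.

Lemma sint_ge0 a b f : (forall x, a <= x <= b -> 0 <= f x) -> 0 <= sint a b f.
Proof. by move=> f0; apply: Rintegral_ge0 => x /=; rewrite in_itv/=; exact: f0. Qed.

Lemma locint_norm f : locint f -> locint (fun x => `|f x|).
Proof. by move=> lf a b; exact: (integrable_norm (lf a b)). Qed.

Lemma ler_norm_sint a b f : locint f -> `|sint a b f| <= sint a b (fun x => `|f x|).
Proof. by move=> lf; apply: le_normr_Rintegral. Qed.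

Lemma sintxx a f : sint a a f = 0.
Proof. by rewrite /sint set_itv1 Rintegral_set1. Qed.

Lemma sint_split c a b f : a <= c -> c <= b -> locint f ->
  sint a b f = sint a c f + sint c b f.
Proof.
move=> ac cb lf; rewrite /sint -(@Rintegral_itv_obnd_cbnd _ c (BRight b) f); last first.
  by apply: integrableS (lf c b) => //; apply: subset_itv_oc_cc.
have := @Rintegral_itvB _ f (BLeft a) (BRight b) c (lf a b).
rewrite !bnd_simp => /(_ ac cb) <-.
by rewrite addrC subrK.
Qed.

(** Reflections generate the translations, so invariance of the Lebesgue measure
    is established for them only.  Functions are not assumed continuous, hence
    the passage through image measures. *)
Definition mirror c : measurableTypeR R -> measurableTypeR R :=
  fun x => c - (x : R).

Let measurable_reflect c : measurable_fun setT (mirror c).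
Proof.
apply: (@continuous_measurable_fun R (mirror c : R -> R)) => x.
by apply: cvgB; [exact: cvg_cst|exact: cvg_id].
Qed.

HB.instance Definition _ c :=
  isMeasurableFun.Build _ _ _ _ (mirror c) (measurable_reflect c).

Let preimage_reflect c a b : mirror c @^-1` `[c - b, c - a] = `[a, b]%classic.
Proof.
apply/seteqP; split => x /=; rewrite !in_itv/= /mirror => /andP[? ?];
  by apply/andP; split; lra.
Qed.

Let pushforward_reflect c A : measurable A ->
  pushforward mu (mirror c) A = mu A.
Proof.
move=> mA; apply/esym/lebesgue_measure_unique => //= _ [[i j]] _ <-.
rewrite /pushforward.
have -> : mirror c @^-1` `]i, j] = `[c - j, c - i[%classic.
  apply/seteqP; split => x /=; rewrite !in_itv/= /mirror => /andP[? ?];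
    by apply/andP; split; lra.
rewrite !lebesgue_measure_itv/= !lte_fin ltrD2l ltrN2.
by case: ifP => // _; rewrite -!EFinD; congr (_%:E); lra.
Qed.

Lemma locint_reflect c f : locint f -> locint (fun x => f (c - x)).
Proof.
move=> lf a b; have mf := locint_measurable lf.
apply/integrableP; split.
  apply/measurable_EFinP; apply: measurable_funTS.
  exact: (measurableT_comp mf (measurable_reflect c)).
rewrite -(preimage_reflect c a b)/=.
rewrite -(@ge0_integral_pushforward _ _ _ _ _ _ (measurable_reflect c) mu
  `[c - b, c - a] (fun x => `|f x|%:E))//=.
- rewrite (eq_measure_integral mu).
    by have /integrableP[_] := lf (c - b) (c - a).
  by move=> A mA _; exact: pushforward_reflect.
- by apply/measurable_EFinP; apply: measurableT_comp => //; exact: measurable_funTS.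
Qed.

Lemma sint_reflect c a b f : locint f ->
  sint a b (fun x => f (c - x)) = sint (c - b) (c - a) f.
Proof.
move=> lf; rewrite /sint /Rintegral; congr fine.
rewrite -(preimage_reflect c a b).
rewrite -(@integral_pushforward _ _ _ _ R (mirror c) (measurable_reflect c) mu
  `[c - b, c - a] (EFin \o f))//.
- by apply: eq_measure_integral => //= A mA AS; exact: pushforward_reflect.
- by apply/measurable_EFinP; exact: locint_measurable.
- by rewrite preimage_reflect; exact: locint_reflect.
Qed.

Lemma locint_shift c f : locint f -> locint (fun x => f (x + c)).
Proof.
move=> /(locint_reflect 0)/(locint_reflect (- c)) lf a b.
rewrite (_ : (fun x => _) = (fun x => f (0 - (- c - x))))//.
by apply/funext => x; congr f; lra.
Qed.

Lemma sint_shift c a b f : locint f ->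
  sint a b (fun x => f (x + c)) = sint (a + c) (b + c) f.
Proof.
move=> lf; transitivity (sint a b (fun x => f (0 - (- c - x)))).
  by apply: eq_sint => x _; congr f; lra.
rewrite (@sint_reflect (- c) a b (fun x => f (0 - x))); last exact: locint_reflect.
by rewrite sint_reflect//; apply: congr_sint; lra.
Qed.

End SegmentIntegral.

(** * Primitives *)

Section Primitive.
Context {R : realType}.
Implicit Types (f g F G : R -> R) (a b c x : R).

Definition primitive f x : R := if 0 <= x then sint 0 x f else - sint x 0 f.

Lemma sint_primitive f a b : locint f -> a <= b ->
  sint a b f = primitive f b - primitive f a.
Proof.
move=> lf ab; rewrite /primitive.
have [b0|b0] := leP 0 b; have [a0|a0] := leP 0 a.
- by rewrite (@sint_split _ a 0 b f)// addrC addKr.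
- by rewrite opprK addrC (@sint_split _ 0 a b f)// ltW.
- by have := lt_le_trans b0 (le_trans a0 ab); rewrite ltxx.
- by rewrite (@sint_split _ b a 0 f)// ?(ltW b0)// opprK addrC addrK.
Qed.

Lemma primitive0 f : primitive f 0 = 0.
Proof. by rewrite /primitive lexx sintxx. Qed.

(* Near [x] the primitive is, up to a constant, an integral with fixed left end,
   whatever the sign of [x]. *)
Let primitive_near f x : locint f ->
  \forall y \near x, primitive f y =
    sint (- (`|x| + 1)) y f + primitive f (- (`|x| + 1)).
Proof.
move=> lf; near=> y; rewrite sint_primitive ?subrK//.
apply: ltW; near: y; apply: lt_nbhsr.
have := ler_norm (- x); rewrite normrN; lra.
Unshelve. all: by end_near. Qed.

Lemma continuous_primitive f : locint f -> continuous (primitive f).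
Proof.
move=> lf x; set N := `|x| + 1.
have Nx : - N < x < N.
  by rewrite -ltr_norml /N ltrDl.
have NN : - N < N by case/andP: Nx => /lt_trans; apply.
have := parameterized_integral_continuous (ltW NN) (lf (- N) N).
case/(continuous_within_itvP _ NN) => /(_ x); rewrite in_itv => /(_ Nx) cx _ _.
have cl : (sint (- N) y f + primitive f (- N)) @[y --> x] --> primitive f x.
  rewrite (nbhs_singleton (primitive_near x lf)).
  by apply: cvgD; [exact: cx|exact: cvg_cst].
apply: cvg_trans cl; apply: near_eq_cvg.
by apply: filterS (primitive_near x lf) => y; exact: esym.
Qed.

Lemma is_derive_primitive f x : continuous f -> is_derive x 1 (primitive f) (f x).
Proof.
move=> cf; set N := `|x| + 1; have lf := continuous_locint cf.
have /andP[Nx xN] : - N < x < N by rewrite -ltr_norml /N ltrDl.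
have [dF F'] := @continuous_FTC1_closed R f (- N) x N xN (lf _ _) Nx (cf x).
have dG : is_derive x 1 (fun y => sint (- N) y f + primitive f (- N)) (f x).
  rewrite -[f x]addr0; apply: is_deriveD.
  apply: DeriveDef; first exact: dF.
  by rewrite -derive1E; exact: F'.
apply: near_eq_is_derive dG => //.
by apply: filterS (primitive_near x lf) => y; exact: esym.
Qed.

Lemma sint_derive f F a b : (forall x, is_derive x 1 F (f x)) -> continuous f ->
  a <= b -> sint a b f = F b - F a.
Proof.
move=> dF cf ab; rewrite sint_primitive//; last exact: continuous_locint.
have dD x : is_derive x 1 (primitive f - F) 0.
  rewrite -(subrr (f x)); apply: is_deriveB; exact: is_derive_primitive.
have := @is_derive_0_is_cst R _ b a dD; rewrite !fctE; lra.
Qed.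

End Primitive.

(** * Integrals of periodic functions *)

Section Periodic.
Context {R : realType}.
Implicit Types (f g : R -> R) (a b c x r : R) (n : nat).

(** As [f] may be discontinuous, the left-hand side is not differentiated in [a];
    instead the increments of the primitive over [a, b] and [a + 2, b + 2] are
    compared. *)
Lemma sint_period f a b : locint f -> periodic f 2 ->
  sint a (a + 2) f = sint b (b + 2) f.
Proof.
move=> lf pf; wlog ab : a b / a <= b.
  by move=> H; case: (leP a b) => [/H//|/ltW/H].
have := sint_shift 2 a b lf.
rewrite (@eq_sint _ _ _ _ f) => [|x _]; last exact: pf.
rewrite !sint_primitive//; lra.
Qed.

Lemma sint_period1 f a : locint f -> periodic f 2 ->
  sint a (a + 2) f = sint (-1) 1 f.
Proof.
by move=> lf pf; rewrite (sint_period a (-1))//; apply: congr_sint; lra.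
Qed.

Lemma sint_even f : locint f -> (forall x, f (- x) = f x) ->
  sint (-1) 1 f = 2 * sint 0 1 f.
Proof.
move=> lf ef; rewrite (@sint_split _ 0)//.
have <- : sint 0 1 (fun x => f (0 - x)) = sint (-1) 0 f.
  by rewrite sint_reflect//; apply: congr_sint; lra.
rewrite (@eq_sint _ _ _ _ f) => [|x _]; last by rewrite sub0r ef.
lra.
Qed.

Lemma le_sint_subset f a b c d : locint f -> (forall x, 0 <= f x) ->
  c <= a -> a <= b -> b <= d -> sint a b f <= sint c d f.
Proof.
move=> lf f0 ca ab bd; rewrite (@sint_split _ a c d)//; last exact: le_trans bd.
rewrite (@sint_split _ b a d)//.
have := sint_ge0 (fun x (_ : c <= x <= a) => f0 x).
have := sint_ge0 (fun x (_ : b <= x <= d) => f0 x); lra.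
Qed.

Lemma sint_window f n a b : locint f -> periodic f 2 -> (forall x, 0 <= f x) ->
  a <= b <= a + n%:R * 2 -> sint a b f <= n%:R * sint (-1) 1 f.
Proof.
move=> lf pf f0 /andP[ab bn].
apply: (le_trans (le_sint_subset lf f0 (lexx _) ab bn)).
rewrite le_eqVlt; apply/orP; left; apply/eqP.
elim: n {b ab bn} => [|n IH]; first by rewrite !mul0r addr0 sintxx.
have n0 : 0 <= n%:R :> R by [].
rewrite (@sint_split _ (a + n%:R * 2))//; [|lra|by rewrite -natr1; lra].
rewrite IH (_ : a + n.+1%:R * 2 = a + n%:R * 2 + 2); last by rewrite -natr1; lra.
by rewrite sint_period1// -natr1; lra.
Qed.

End Periodic.

(** * Convolution with the truncated identity kernel *)

Section Convolution.
Context {R : realType}.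
Implicit Types (f g q : R -> R) (a b c x r m C : R) (n : nat).

Lemma conv_wE r f x :
  conv_w r f x = sint (x - r) (x + r) (fun y => (x - y) * f y).
Proof.
rewrite /conv_w /sint Rintegral_mkcond [RHS]Rintegral_mkcond; apply: eq_Rintegral => y _.
rewrite !patchE in_setT /kernel_w.
have -> : (y \in `[x - r, x + r]%classic) = (`|x - y| <= r).
  apply/idP/idP; rewrite inE/= in_itv/= ler_norml => /andP[? ?]; apply/andP; split; lra.
by case: ifP => //; rewrite mul0r.
Qed.

Lemma continuous_subl x : continuous (fun y : R => x - y).
Proof. by move=> y; apply: cvgB; [exact: cvg_cst|exact: cvg_id]. Qed.

Lemma locint_kernel f x : locint f -> locint (fun y => (x - y) * f y).
Proof. by move=> lf; apply: locint_mulcont => //; exact: continuous_subl. Qed.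

Lemma conv_wB r f g x : locint f -> locint g ->
  conv_w r (fun y => f y - g y) x = conv_w r f x - conv_w r g x.
Proof.
move=> lf lg; rewrite !conv_wE -sintB; [|exact: locint_kernel..].
by apply: eq_sint => y _; rewrite mulrBr.
Qed.

Lemma conv_w_periodic r f : locint f -> periodic f 2 -> periodic (conv_w r f) 2.
Proof.
move=> lf pf x; rewrite !conv_wE.
have := sint_shift 2 (x - r) (x + r) (locint_kernel (x + 2) lf).
rewrite [RHS](_ : _ = sint (x + 2 - r) (x + 2 + r) (fun y => (x + 2 - y) * f y)); last first.
  by apply: congr_sint; lra.
move=> <-; apply: eq_sint => y _; rewrite pf; congr (_ * _); lra.
Qed.

Lemma conv_w_odd r f x : locint f -> (forall y, f (- y) = f y) ->
  conv_w r f (- x) = - conv_w r f x.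
Proof.
move=> lf ef; rewrite !conv_wE -[RHS]mulN1r -sintZ; last exact: locint_kernel.
have := sint_reflect 0 (x - r) (x + r) (locint_kernel (- x) lf).
rewrite [RHS](_ : _ = sint (- x - r) (- x + r) (fun y => (- x - y) * f y)); last first.
  by apply: congr_sint; lra.
by move=> <-; apply: eq_sint => y _; rewrite sub0r ef; lra.
Qed.

(** Folding the kernel at its centre shows the two contributions of opposite
    sign that have to be compared. *)
Lemma conv_w_fold r f x : 0 <= r -> locint f ->
  conv_w r f x = sint 0 r (fun z => z * (f (x - z) - f (z + x))).
Proof.
move=> r0 lf; rewrite conv_wE (@sint_split _ x)//; [|lra|lra|exact: locint_kernel].
have lk := locint_kernel x lf.
have <- : sint 0 r (fun z => (x - (x - z)) * f (x - z)) =
          sint (x - r) x (fun y => (x - y) * f y).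
  by rewrite (sint_reflect x 0 r lk); apply: congr_sint; lra.
have <- : sint 0 r (fun z => (x - (z + x)) * f (z + x)) =
          sint x (x + r) (fun y => (x - y) * f y).
  by rewrite (sint_shift x 0 r lk); apply: congr_sint; lra.
rewrite -sintD; last 2 first.
- exact: (locint_reflect x lk).
- exact: (locint_shift x lk).
by apply: eq_sint => z _; lra.
Qed.

(* Both weighted integrals lie in [0, C m], hence so does the modulus of their
   difference. *)
Let weighted_diff q f g a b m C : continuous q -> locint f -> locint g ->
  (forall z, 0 <= f z) -> (forall z, 0 <= g z) ->
  (forall z, a <= z <= b -> 0 <= q z <= C) -> 0 <= C ->
  sint a b f <= m -> sint a b g <= m ->
  `|sint a b (fun z => q z * (f z - g z))| <= C * m.
Proof.
move=> cq lf lg f0 g0 q0C C0 fm gm.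
have lqf := locint_mulcont cq lf; have lqg := locint_mulcont cq lg.
rewrite (@eq_sint _ _ _ _ (fun z => q z * f z - q z * g z)) => [|z _]; last by rewrite mulrBr.
rewrite sintB//.
have bound h : locint h -> (forall z, 0 <= h z) -> sint a b h <= m ->
    0 <= sint a b (fun z => q z * h z) <= C * m.
  move=> lh h0 hm; apply/andP; split.
    by apply: sint_ge0 => z /q0C/andP[q0 _]; exact: mulr_ge0.
  apply: (@le_trans _ _ (sint a b (fun z => C * h z))).
    apply: le_sint => [||z /q0C/andP[_ qC]].
    - exact: locint_mulcont.
    - exact: locintZ.
    - by rewrite ler_wpM2r.
  by rewrite sintZ// ler_wpM2l.
have /andP[? ?] := bound _ lf f0 fm; have /andP[? ?] := bound _ lg g0 gm.
by rewrite ler_norml; apply/andP; split; lra.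
Qed.

(** For [r <= 2] each half of the folded integral lies between [0] and [r] times
    the mass of one period.  Enlarging [r] by a period adds the shell
    [[s, s + 2]], over which both reflections of [f] have the same mass, so that
    the weight [z] may be replaced by [z - s], which is at most [2]. *)
Lemma conv_w_bound_ge0 r f x : 0 <= r -> locint f -> periodic f 2 ->
  (forall y, 0 <= f y) -> `|conv_w r f x| <= r * sint (-1) 1 f.
Proof.
move=> r0 lf pf f0; rewrite conv_w_fold//.
set d := fun z => f (x - z) - f (z + x); set m := sint (-1) 1 f.
have l1 := locint_reflect x lf; have l2 := locint_shift x lf.
have ld : locint d by exact: locintB.
have cid : continuous (fun z : R => z) by move=> z; exact: cvg_id.
have per1 s : sint s (s + 2) (fun z => f (x - z)) = m.
  rewrite sint_reflect// /m -(sint_period1 (x - (s + 2)))//; apply: congr_sint; lra.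
have per2 s : sint s (s + 2) (fun z => f (z + x)) = m.
  rewrite sint_shift// /m -(sint_period1 (s + x))//; apply: congr_sint; lra.
have [n] : exists n, r <= n.+1%:R * 2.
  exists (Num.truncn r); have := truncnS_gt r; lra.
elim: n r r0 => [|n IH] r r0 rn.
  apply: weighted_diff => //.
  - by rewrite -(per1 0); apply: le_sint_subset => //; lra.
  - by rewrite -(per2 0); apply: le_sint_subset => //; lra.
have [r2|r2] := leP r 2; first by apply: IH => //; rewrite -natr1 mulrDl;
  have : 0 <= n%:R :> R by []; lra.
have [s rE] : exists s, r = s + 2 by exists (r - 2); lra.
have s0 : 0 <= s by lra.
have lz : locint (fun z => z * d z) by exact: locint_mulcont.
have lzs : locint (fun z => (z - s) * d z).
  by apply: locint_mulcont => // z; apply: cvgB; [exact: cvg_id|exact: cvg_cst].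
rewrite rE (@sint_split _ s)//; last by lra.
have -> : sint s (s + 2) (fun z => z * d z) = sint s (s + 2) (fun z => (z - s) * d z).
  rewrite (@eq_sint _ _ _ _ (fun z => (z - s) * d z + s * d z)) => [|z _]; last by lra.
  rewrite sintD//; last exact: locintZ.
  by rewrite sintZ// sintB// per1 per2 subrr mulr0 addr0.
rewrite mulrDl; apply: (le_trans (ler_normD _ _)); apply: lerD.
  by apply: IH => //; move: rn; rewrite rE -natr1; lra.
apply: weighted_diff => //.
- by move=> z; apply: cvgB; [exact: cvg_id|exact: cvg_cst].
- move=> z; lra.
- by rewrite per1.
- by rewrite per2.
Qed.

(** Splitting [f] into its positive and negative parts. *)
Lemma conv_w_bound r f x : 0 <= r -> locint f -> periodic f 2 ->
  `|conv_w r f x| <= r * sint (-1) 1 (fun y => `|f y|).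
Proof.
move=> r0 lf pf; have lnf := locint_norm lf.
pose fp y := 2^-1 * (`|f y| + f y); pose fm y := 2^-1 * (`|f y| - f y).
have lp : locint fp by apply: locintZ; exact: locintD.
have lm : locint fm by apply: locintZ; exact: locintB.
have fE : f = fun y => fp y - fm y by apply/funext => y; rewrite /fp /fm; lra.
have nE : sint (-1) 1 (fun y => `|f y|) = sint (-1) 1 fp + sint (-1) 1 fm.
  by rewrite -sintD//; apply: eq_sint => y _; rewrite /fp /fm; lra.
rewrite nE [in X in `|X|]fE conv_wB// mulrDr.
apply: (le_trans (ler_normB _ _)); apply: lerD; apply: conv_w_bound_ge0 => // y.
- by rewrite /fp pf.
- by rewrite /fp; have := ler_norm (- f y); rewrite normrN; lra.
- by rewrite /fm pf.
- by rewrite /fm; have := ler_norm (f y); lra.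
Qed.

End Convolution.

(** * Differential calculus and the Wirtinger inequality *)

Section RealCalculus.
Context {R : realType}.
Implicit Types (f g F G u v : R -> R) (a b c k x : R).

Lemma cont_cst c : continuous (fun _ : R => c).
Proof. by move=> x; exact: cvg_cst. Qed.

Lemma cont_id : continuous (fun x : R => x).
Proof. by move=> x; exact: cvg_id. Qed.

Lemma cont_add f g : continuous f -> continuous g ->
  continuous (fun x => f x + g x).
Proof. by move=> cf cg x; apply: cvgD; [exact: cf|exact: cg]. Qed.

Lemma cont_opp f : continuous f -> continuous (fun x => - f x).
Proof. by move=> cf x; apply: cvgN; exact: cf. Qed.

Lemma cont_sub f g : continuous f -> continuous g ->
  continuous (fun x => f x - g x).
Proof. by move=> cf cg x; apply: cvgB; [exact: cf|exact: cg]. Qed.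

Lemma cont_mul f g : continuous f -> continuous g ->
  continuous (fun x => f x * g x).
Proof. by move=> cf cg x; apply: cvgM; [exact: cf|exact: cg]. Qed.

Lemma cont_sqr f : continuous f -> continuous (fun x => f x ^+ 2).
Proof. by move=> cf; apply: cont_mul. Qed.

Lemma cont_norm f : continuous f -> continuous (fun x => `|f x|).
Proof. by move=> cf x; apply: cvg_norm; exact: cf. Qed.

Lemma cont_inv f : (forall x, f x != 0) -> continuous f ->
  continuous (fun x => (f x)^-1).
Proof. by move=> f0 cf x; apply: cvgV; [exact: f0|exact: cf]. Qed.

Lemma cont_comp f g : continuous f -> continuous g ->
  continuous (fun x => f (g x)).
Proof. by move=> cf cg x; apply: (@continuous_comp _ _ _ g f); [exact: cg|exact: cf]. Qed.

Lemma is_derive_cont f g : (forall x, is_derive x 1 f (g x)) -> continuous f.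
Proof.
by move=> df x; apply/differentiable_continuous/derivable1_diffP.
Qed.

Lemma is_derive_derive1 f x l : is_derive x 1 f l -> derive1 f x = l.
Proof. by move=> df; rewrite derive1E; exact: derive_val. Qed.

Lemma is_derive_derivable f x l : is_derive x 1 f l -> derivable f x 1.
Proof. by case. Qed.

Lemma is_derive_add f g x a b : is_derive x 1 f a -> is_derive x 1 g b ->
  is_derive x 1 (fun y => f y + g y) (a + b).
Proof. by move=> df dg; exact: is_deriveD. Qed.

Lemma is_derive_sub f g x a b : is_derive x 1 f a -> is_derive x 1 g b ->
  is_derive x 1 (fun y => f y - g y) (a - b).
Proof. by move=> df dg; exact: is_deriveB. Qed.

Lemma is_derive_mul f g x a b : is_derive x 1 f a -> is_derive x 1 g b ->
  is_derive x 1 (fun y => f y * g y) (a * g x + f x * b).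
Proof.
move=> df dg; have H := is_deriveM df dg.
rewrite (_ : a * g x + f x * b = f x *: b + g x *: a); first exact: H.
by rewrite addrC; congr (_ + _); rewrite /GRing.scale/= mulrC.
Qed.

Lemma is_derive_scale f x k a : is_derive x 1 f a ->
  is_derive x 1 (fun y => k * f y) (k * a).
Proof.
move=> df; rewrite -[k * a]add0r -(mul0r (f x)).
by apply: is_derive_mul; exact: is_derive_cst.
Qed.

Lemma is_derive_affine f x k c l : is_derive (k * x + c) 1 f l ->
  is_derive x 1 (fun y => f (k * y + c)) (l * k).
Proof.
move=> df; apply: (@is_derive1_comp _ f (fun y => k * y + c)) => //.
rewrite -[k in is_derive _ _ _ k]addr0; apply: is_derive_add.
by rewrite -[X in is_derive _ _ _ X](mulr1 k); apply: is_derive_scale.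
Qed.

Lemma is_derive_translate f x c l : is_derive (x + c) 1 f l ->
  is_derive x 1 (fun y => f (y + c)) l.
Proof.
move=> df; have : is_derive (1 * x + c) 1 f l by rewrite mul1r.
move=> /is_derive_affine; rewrite mulr1.
by under eq_fun do rewrite mul1r.
Qed.

Lemma is_derive_sqr f x a : is_derive x 1 f a ->
  is_derive x 1 (fun y => f y ^+ 2) (2 * (f x * a)).
Proof.
move=> df; rewrite (_ : 2 * (f x * a) = a * f x + f x * a); last by lra.
exact: (is_derive_mul df df).
Qed.

Lemma sint_cauchy_schwarz a b f g : continuous f -> continuous g ->
  sint a b (fun x => f x * g x) ^+ 2 <=
  sint a b (fun x => f x ^+ 2) * sint a b (fun x => g x ^+ 2).
Proof.
move=> cf cg.
set A := sint a b (fun x => f x ^+ 2); set B := sint a b (fun x => f x * g x).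
set C := sint a b (fun x => g x ^+ 2).
have lff := continuous_locint (cont_sqr cf).
have lgg := continuous_locint (cont_sqr cg).
have lfg := continuous_locint (cont_mul cf cg).
have quad t : 0 <= A - 2 * t * B + t ^+ 2 * C.
  have <- : sint a b (fun x => (f x - t * g x) ^+ 2) = A - 2 * t * B + t ^+ 2 * C.
    rewrite (@eq_sint _ _ _ _ (fun x => (f x ^+ 2 - (2 * t) * (f x * g x)) + t ^+ 2 * g
      x ^+ 2)).
      rewrite sintD; [|by apply: locintB => //; exact: locintZ|exact: locintZ].
      by rewrite sintB ?sintZ//; exact: locintZ.
    by move=> x _; ring.
  by apply: sint_ge0 => x _; exact: sqr_ge0.
have A0 : 0 <= A by apply: sint_ge0 => x _; exact: sqr_ge0.
have : 0 <= C by apply: sint_ge0 => x _; exact: sqr_ge0.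
rewrite le_eqVlt => /predU1P[C0|C0].
  have [->|B0] := eqVneq B 0; first by rewrite expr0n/= -C0 mulr0.
  (* [t] is chosen to make the affine function [A - 2 t B] equal to [-1]. *)
  have := quad ((A + 1) / (2 * B)); rewrite -C0 mulr0 addr0.
  rewrite (_ : 2 * ((A + 1) / (2 * B)) * B = A + 1); last by field.
  lra.
have := quad (B / C).
rewrite (_ : _ + _ = (A * C - B ^+ 2) / C); last by field; exact: lt0r_neq0.
by rewrite pmulr_lge0 ?invr_gt0// subr_ge0.
Qed.

(** The function [T = k tan (k (x - 1/2))] is smooth on [0, 1] because [k < pi],
    and solves [T' = k^2 + T^2].  Hence [v^2 - k^2 u^2 + (T u^2)'] is the square
    of [v + T u], where [v = u'], and the boundary terms vanish with [u]. *)
Lemma dirichlet_poincare k u v : 0 < k < pi ->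
  (forall x, is_derive x 1 u (v x)) -> continuous v -> u 0 = 0 -> u 1 = 0 ->
  k ^+ 2 * sint 0 1 (fun x => u x ^+ 2) <= sint 0 1 (fun x => v x ^+ 2).
Proof.
move=> /andP[k0 kpi] du cv u0 u1; have cu := is_derive_cont du.
pose q x := v x ^+ 2 - k ^+ 2 * u x ^+ 2.
have cq : continuous q.
  apply: cont_sub; first exact: cont_sqr.
  by apply: cont_mul; [exact: cont_cst|exact: cont_sqr].
pose T x := k * tan (k * x + - (k / 2)).
pose H x := primitive q x + T x * u x ^+ 2.
have dH x : 0 <= x <= 1 -> is_derive x 1 H ((v x + T x * u x) ^+ 2).
  move=> x01; have cos0 : cos (k * x + - (k / 2)) != 0.
    have kx : 0 <= k * x <= k by apply/andP; split; nra.
    by apply: lt0r_neq0; apply: cos_gt0_pihalf; apply/andP; split; lra.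
  have dT : is_derive x 1 T (k * ((cos (k * x + - (k / 2))) ^- 2 * k)).
    by apply: is_derive_scale; apply: is_derive_affine; exact: is_derive_tan.
  apply: is_derive_eq (is_derive_add (is_derive_primitive x cq)
    (is_derive_mul dT (is_derive_sqr (du x)))) _.
  by rewrite /q /T cos2_tan2//; ring.
have H01 : H 0 <= H 1.
  apply: (@ger0_derive1_le_cc _ H 0 1).
  - by move=> x; rewrite in_itv/= => /andP[? ?]; apply: is_derive_derivable (dH x _);
      apply/andP; split; exact: ltW.
  - move=> x; rewrite in_itv/= => /andP[? ?].
    rewrite (is_derive_derive1 (dH x _)) ?sqr_ge0//; apply/andP; split; exact: ltW.
  - apply: derivable_within_continuous => x; rewrite in_itv/= => x01.
    exact: is_derive_derivable (dH x x01).
  - by rewrite in_itv/= lexx ler01.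
  - by rewrite in_itv/= lexx ler01.
  - exact: ler01.
move: H01; rewrite /H u0 u1 expr0n/= !mulr0 !addr0 -subr_ge0.
rewrite -sint_primitive//; last exact: continuous_locint.
rewrite sintB ?sintZ ?subr_ge0//.
- exact/continuous_locint/cont_sqr.
- exact/continuous_locint/cont_sqr.
- exact/locintZ/continuous_locint/cont_sqr.
Qed.

(** Wirtinger's inequality with the sharp Neumann constant: apply the Dirichlet
    inequality to the primitive of [u] and integrate by parts. *)
Lemma neumann_poincare u v :
  (forall x, is_derive x 1 u (v x)) -> continuous v -> sint 0 1 u = 0 ->
  pi ^+ 2 * sint 0 1 (fun x => u x ^+ 2) <= sint 0 1 (fun x => v x ^+ 2).
Proof.
move=> du cv u0; have cu := is_derive_cont du.
pose U := primitive u.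
have dU x : is_derive x 1 U (u x) by exact: is_derive_primitive.
have cU := is_derive_cont dU.
have U0 : U 0 = 0 by exact: primitive0.
have U1 : U 1 = 0.
  have := sint_primitive (continuous_locint cu) ler01.
  by rewrite u0 -/U U0 subr0.
set a := sint 0 1 (fun x => u x ^+ 2); set b := sint 0 1 (fun x => v x ^+ 2).
set c := sint 0 1 (fun x => U x ^+ 2).
have luu := continuous_locint (cont_sqr cu).
have lvv := continuous_locint (cont_sqr cv).
have lUU := continuous_locint (cont_sqr cU).
have lUv := continuous_locint (cont_mul cU cv).
have parts : a = - sint 0 1 (fun x => U x * v x).
  have dUu x : is_derive x 1 (fun y => U y * u y) (u x ^+ 2 + U x * v x).
    by rewrite expr2; exact: is_derive_mul.
  have := @sint_derive _ _ _ 0 1 dUu.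
  rewrite sintD// U0 U1 !mul0r subrr => H; apply/eqP; rewrite -addr_eq0; apply/eqP.
  apply: H => //; apply: cont_add; [exact: cont_sqr|exact: cont_mul].
have a0 : 0 <= a by apply: sint_ge0 => x _; exact: sqr_ge0.
(* Only [k < pi] is available in the Dirichlet inequality; the sharp constant
   follows by letting [k] tend to [pi]. *)
have kab k : 0 < k < pi -> k ^+ 2 * a <= b.
  move=> kp; have k0 : 0 < k by case/andP: kp.
  have ca : k ^+ 2 * c <= a by exact: (dirichlet_poincare kp dU).
  have CS : a ^+ 2 <= c * b.
    by rewrite parts sqrrN; exact: sint_cauchy_schwarz.
  have [->|a1] := eqVneq a 0.
    by rewrite mulr0; apply: sint_ge0 => x _; exact: sqr_ge0.
  have ap : 0 < a by rewrite lt_def a1.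
  have b0 : 0 <= b by apply: sint_ge0 => x _; exact: sqr_ge0.
  rewrite -(ler_pM2l ap) (le_trans _ (ler_wpM2r b0 ca))//.
  by rewrite -[leRHS]mulrA mulrCA ler_wpM2l ?sqr_ge0.
rewrite leNgt; apply/negP => bpa.
have pi0 := pi_gt0 R.
have ap : 0 < a.
  rewrite lt_def a0 andbT; apply: contraTneq bpa => ->.
  by rewrite mulr0 -leNgt; apply: sint_ge0 => x _; exact: sqr_ge0.
have ba : b / a < pi ^+ 2 by rewrite ltr_pdivrMr.
have b0 : 0 <= b / a by apply: divr_ge0 => //; apply: sint_ge0 => x _; exact: sqr_ge0.
pose s := (b / a + pi ^+ 2) / 2.
have s0 : 0 < s by rewrite /s; have := exprn_gt0 2 pi0; lra.
have kp : 0 < Num.sqrt s < pi.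
  rewrite sqrtr_gt0 s0/= -(ltr_pXn2r (n := 2))// ?nnegrE ?sqrtr_ge0 ?pi_ge0//.
  by rewrite sqr_sqrtr ?ltW// /s; lra.
have := kab _ kp; rewrite sqr_sqrtr; last exact: ltW.
rewrite -ler_pdivlMr// /s; lra.
Qed.

End RealCalculus.

(** * Regularity of the convolution *)

Section ConvolutionRegularity.
Context {R : realType}.
Implicit Types (f g : R -> R) (a b c x r : R) (n : nat).

(* Regularity comes from this expression through primitives, in which [x] no
   longer occurs under the integral sign. *)
Let conv_w_primitive r f x : 0 <= r -> locint f ->
  conv_w r f x =
  x * (primitive f (x + r) - primitive f (x - r)) -
  (primitive (fun y => y * f y) (x + r) - primitive (fun y => y * f y) (x - r)).
Proof.
move=> r0 lf; have lyf : locint (fun y => y * f y).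
  exact: (locint_mulcont cont_id lf).
rewrite conv_wE (@eq_sint _ _ _ _ (fun y => x * f y - y * f y)) => [|y _]; last exact: mulrBl.
rewrite sintB//; last exact: locintZ.
by rewrite sintZ// !sint_primitive//; lra.
Qed.

Lemma continuous_conv_w r f : 0 <= r -> locint f -> continuous (conv_w r f).
Proof.
move=> r0 lf; have lyf : locint (fun y => y * f y).
  exact: (locint_mulcont cont_id lf).
rewrite (_ : conv_w r f = fun x => x * (primitive f (x + r) - primitive f (x - r)) -
  (primitive (fun y => y * f y) (x + r) - primitive (fun y => y * f y) (x - r))); last first.
  by apply/funext => x; exact: conv_w_primitive.
have shift g c : locint g -> continuous (fun x => primitive g (x + c)).
  move=> lg; apply: (@cont_comp _ (primitive g) (fun x => x + c)).
    exact: continuous_primitive.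
  by apply: cont_add; [exact: cont_id|exact: cont_cst].
apply: cont_sub; last by apply: cont_sub; exact: shift.
by apply: cont_mul; [exact: cont_id|apply: cont_sub; exact: shift].
Qed.

Definition conv_w_deriv r f x :=
  primitive f (x + r) - primitive f (x - r) - r * (f (x + r) + f (x - r)).

Lemma is_derive_conv_w r f x : 0 <= r -> continuous f ->
  is_derive x 1 (conv_w r f) (conv_w_deriv r f x).
Proof.
move=> r0 cf; have lf := continuous_locint cf.
have cyf : continuous (fun y : R => y * f y) by apply: cont_mul => //; exact: cont_id.
rewrite (_ : conv_w r f = fun x => x * (primitive f (x + r) - primitive f (x - r)) -
  (primitive (fun y => y * f y) (x + r) - primitive (fun y => y * f y) (x - r))); last first.
  by apply/funext => y; exact: conv_w_primitive.
have shift g c : continuous g ->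
    is_derive x 1 (fun y => primitive g (y + c)) (g (x + c)).
  by move=> cg; apply: is_derive_translate; exact: is_derive_primitive.
have diff g : continuous g ->
    is_derive x 1 (fun y => primitive g (y + r) - primitive g (y - r)) (g (x + r) - g (x - r)).
  by move=> cg; apply: is_derive_sub; exact: shift.
apply: is_derive_eq (is_derive_sub (is_derive_mul (is_derive_id _ _) (diff _ cf)) (diff
  _ cyf)) _.
by rewrite /conv_w_deriv; ring.
Qed.

Lemma continuous_conv_w_deriv r f : continuous f -> continuous (conv_w_deriv r f).
Proof.
move=> cf; have ct c : continuous (fun x : R => x + c).
  by apply: cont_add; [exact: cont_id|exact: cont_cst].
have cp := continuous_primitive (continuous_locint cf).
rewrite /conv_w_deriv; apply: cont_sub.
  by apply: cont_sub; exact: (cont_comp cp (ct _)).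
apply: cont_mul; first exact: cont_cst.
by apply: cont_add; exact: (cont_comp cf (ct _)).
Qed.

(** Cauchy-Schwarz against the kernel, whose square has integral [2/3 r^3]; the
    window of length [2 r] is covered by at most [r + 1] periods. *)
Lemma conv_w_sqr_bound r f x : 0 <= r -> continuous f -> periodic f 2 ->
  conv_w r f x ^+ 2 <=
  2 / 3 * r ^+ 3 * ((r + 1) * sint (-1) 1 (fun y => f y ^+ 2)).
Proof.
move=> r0 cf pf; rewrite conv_wE.
apply: (le_trans (sint_cauchy_schwarz _ _ (continuous_subl (x := x)) cf)).
have -> : sint (x - r) (x + r) (fun y => (x - y) ^+ 2) = 2 / 3 * r ^+ 3.
  have dF (y : R) : is_derive y 1 (fun y : R => (y - x) ^+ 3 / 3) ((x - y) ^+ 2).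
    have d1 : is_derive y 1 (fun y : R => y - x) 1.
      by rewrite -[X in is_derive _ _ _ X]subr0; apply: is_derive_sub; exact: is_derive_cst.
    have d3 := is_derive_mul (is_derive_mul d1 d1) d1.
    rewrite (_ : (fun y : R => (y - x) ^+ 3 / 3) = (fun y => 3^-1 * ((y - x) * (y - x)
      * (y - x)))).
      by apply: is_derive_eq (is_derive_scale 3^-1 d3) _; field.
    by apply/funext => z; field.
  rewrite (sint_derive dF); [by field| |by lra].
  by apply: cont_sqr; exact: continuous_subl.
rewrite ler_wpM2l//; first by rewrite mulr_ge0// exprn_ge0.
have cff := cont_sqr cf.
apply: (@le_trans _ _ ((Num.truncn r).+1%:R * sint (-1) 1 (fun y => f y ^+ 2))).
  apply: sint_window.
  - exact: continuous_locint.
  - by move=> y; rewrite pf.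
  - by move=> y; exact: sqr_ge0.
  - by have := truncnS_gt r; lra.
rewrite ler_wpM2r//; first by apply: sint_ge0 => y _; exact: sqr_ge0.
by rewrite -natr1 lerD2r truncn_le.
Qed.

End ConvolutionRegularity.

(** * The noise threshold *)

Section Threshold.
Context {R : realType}.
Implicit Types (A B C s r M : R).

(** In the variable [y = s^2] the function [y - A - B exp (C / y)] is increasing;
    it is negative at [A] and nonnegative at [A + B exp (C / A)]. *)
Lemma threshold_exists_unique A B C : 0 < A -> 0 < B -> 0 < C ->
  exists! s : R, 0 < s /\ s ^+ 2 = A + B * expR (C / s ^+ 2).
Proof.
move=> A0 B0 C0.
pose g y := y - A - B * expR (C / y).
have gincr y z : 0 < y -> y < z -> g y < g z.
  move=> y0 yz; rewrite /g; have : expR (C / z) < expR (C / y).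
    by rewrite ltr_expR ltr_pM2l// ltf_pV2// posrE// (lt_trans y0).
  by rewrite -(ltr_pM2l B0); lra.
pose h s := s ^+ 2 - A - B * expR (C / s ^+ 2).
have E0 : 0 < expR (C / A) by exact: expR_gt0.
pose y1 := A + B * expR (C / A).
have Ay1 : A < y1 by rewrite /y1 ltrDl mulr_gt0.
have y1_gt0 : 0 < y1 by exact: lt_trans Ay1.
have le12 : Num.sqrt A <= Num.sqrt y1 by rewrite ler_sqrt// ltW.
have sA : 0 < Num.sqrt A by rewrite sqrtr_gt0.
have ch : {within `[Num.sqrt A, Num.sqrt y1], continuous h}.
  apply/continuous_in_subspaceT => s; rewrite inE/= in_itv/= => /andP[sAs _].
  have s0 : s ^+ 2 != 0 by rewrite expf_eq0/= gt_eqF// (lt_le_trans sA).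
  have c2 : {for s, continuous (fun x : R => x ^+ 2)} by exact: (cont_sqr cont_id).
  apply: cvgB.
    by apply: cvgB; [exact: c2|exact: cvg_cst].
  apply: cvgM; first exact: cvg_cst.
  apply: (@continuous_comp _ _ _ (fun x : R => C / x ^+ 2) expR); last exact: continuous_expR.
  by apply: cvgM; [exact: cvg_cst|apply: cvgV => //; exact: c2].
have hE s : h s = g (s ^+ 2) by [].
have [s sin hs0] : exists2 s, s \in `[Num.sqrt A, Num.sqrt y1] & h s = 0.
  apply: IVT => //.
  have h1 : h (Num.sqrt A) <= 0.
    by have := mulr_gt0 B0 E0; rewrite hE sqr_sqrtr ?(ltW A0)// /g; lra.
  have h2 : 0 <= h (Num.sqrt y1).
    have : B * expR (C / y1) <= B * expR (C / A).
      by rewrite ler_pM2l// ler_expR ler_pM2l// lef_pV2 ?posrE// ltW.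
    by rewrite hE sqr_sqrtr ?(ltW y1_gt0)// /g [in y1 - A]/y1; lra.
  by rewrite ge_min h1/= le_max h2 orbT.
have s0 : 0 < s by move: sin; rewrite in_itv/= => /andP[? _]; exact: lt_le_trans sA _.
exists s; split.
  by split=> //; move: hs0; rewrite /h; lra.
move=> t [t0 tE].
have ht : h t = 0 by rewrite /h; lra.
have sq (a b : R) : 0 < a -> a < b -> a ^+ 2 < b ^+ 2.
  by move=> a0 ab; rewrite ltr_pXn2r ?nnegrE ?ltW// (lt_trans a0).
have [st|ts|//] := ltgtP s t.
  have := gincr _ _ (exprn_gt0 2 s0) (sq _ _ s0 st); rewrite -!hE hs0 ht ltxx//.
have := gincr _ _ (exprn_gt0 2 t0) (sq _ _ t0 ts); rewrite -!hE hs0 ht ltxx//.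
Qed.

Lemma above_threshold A B C s t : 0 < A -> 0 < B -> 0 < C ->
  0 < s -> s ^+ 2 = A + B * expR (C / s ^+ 2) -> s < t ->
  A + B * expR (C / t ^+ 2) < t ^+ 2.
Proof.
move=> A0 B0 C0 s0 sE st; have t0 : 0 < t by exact: lt_trans st.
have s2t2 : s ^+ 2 < t ^+ 2 by rewrite ltr_pXn2r ?nnegrE ?ltW.
apply: (le_lt_trans _ s2t2); rewrite sE lerD2l ler_pM2l// ler_expR ler_pM2l//.
by rewrite lef_pV2 ?posrE ?exprn_gt0// ltW.
Qed.

End Threshold.

(** * Fixed points of contractions in the uniform norm *)

Section UniformContraction.
Context {R : realType}.
Implicit Types (f g : R -> R).

(** Banach's fixed point theorem for functions on the line and uniform distance.
    The class [K] of functions on which [T] contracts has to be closed under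
    uniform limits. *)
Lemma uniform_contraction_fixpoint (K : (R -> R) -> Prop)
    (T : (R -> R) -> R -> R) (q C : R) f0 :
  0 < q < 1 -> 0 < C ->
  (forall f, K f -> K (T f)) ->
  (forall f g (c : R), K f -> K g -> 0 < c -> (forall x, `|f x - g x| <= c) ->
     forall x, `|T f x - T g x| <= q * c) ->
  (forall (u : nat -> R -> R) f, (forall n, K (u n)) ->
     (forall e : R, 0 < e -> exists n, forall x, `|u n x - f x| <= e) -> K f) ->
  K f0 -> (forall x, `|T f0 x - f0 x| <= C) ->
  exists2 f, K f & forall x, T f x = f x.
Proof.
move=> /andP[q0 q1] C0 KT contr Klim K0 bound0.
pose u n := iter n T f0.
have Ku n : K (u n) by elim: n => [//|n IH]; exact: KT.
have step n x : `|u n.+1 x - u n x| <= C * q ^+ n.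
  elim: n x => [|n IH] x; first by rewrite expr0 mulr1; exact: bound0.
  have := contr _ _ _ (Ku n.+1) (Ku n) _ IH x.
  by rewrite exprS mulrCA; apply; rewrite mulr_gt0// exprn_gt0.
pose B := C / (1 - q).
have B0 : 0 < B by rewrite divr_gt0// subr_gt0.
have tail n k x : `|u (n + k)%N x - u n x| <= B * q ^+ n * (1 - q ^+ k).
  elim: k => [|k IH]; first by rewrite addn0 subrr normr0 expr0 subrr mulr0.
  rewrite addnS -(subrK (u (n + k)%N x) (u (n + k).+1 x)) -addrA.
  apply: (le_trans (ler_normD _ _)); apply: (le_trans (lerD (step _ _) IH)).
  rewrite le_eqVlt; apply/orP; left; apply/eqP.
  by rewrite /B exprD exprS; field; rewrite subr_eq0 eq_sym lt_eqF.
have tail' n m x : (n <= m)%N -> `|u m x - u n x| <= B * q ^+ n.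
  move=> nm; rewrite -(subnKC nm); apply: (le_trans (tail _ _ _)).
  have qk0 k : 0 <= q ^+ k by rewrite exprn_ge0// ltW.
  by rewrite ler_piMr ?(mulr_ge0 (ltW B0) (qk0 _))// gerBl.
have small e : 0 < e -> exists n, B * q ^+ n <= e.
  move=> e0.
  have : B * q ^+ n @[n --> \oo] --> B * 0.
    by apply: cvgM; [exact: cvg_cst|apply: cvg_expr; rewrite gtr0_norm].
  rewrite mulr0 => /cvgr0_norm_le/(_ e e0)[n _ /(_ n (leqnn n))].
  by move=> /(le_trans (ler_norm _)); exists n.
have ucvg x : cvgn (fun n => u n x).
  apply/cauchy_cvgP/cauchy_exP => e e0.
  have [n nB] := small (e / 2) (divr_gt0 e0 (ltr0n _ 2)).
  exists (u n x); exists n => // i /= ni; rewrite /ball/=.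
  rewrite distrC; apply: (le_lt_trans (le_trans (tail' _ _ x ni) nB)); lra.
pose f x := limn (fun n => u n x).
have uf n x : `|u n x - f x| <= B * q ^+ n.
  rewrite distrC.
  have cv : `|u m x - u n x| @[m --> \oo] --> `|f x - u n x|.
    by apply: cvg_norm; apply: cvgB; [exact: ucvg|exact: cvg_cst].
  rewrite -(cvg_lim _ cv)//; apply: limr_le; first by apply/cvg_ex; exists (`|f x - u n x|).
  by near=> m; apply: tail'; near: m; exact: nbhs_infty_ge.
have Kf : K f.
  apply: (Klim u) => // e /small[n nB]; exists n => x.
  exact: le_trans (uf n x) nB.
exists f => // x; apply/eqP; rewrite -subr_eq0 -normr_le0.
apply/ler_addgt0Pr => e e0; rewrite add0r.
have [n nB] := small (e / 2) (divr_gt0 e0 (ltr0n _ 2)).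
have Bq0 : 0 < B * q ^+ n by rewrite mulr_gt0// exprn_gt0.
rewrite -(subrK (u n.+1 x) (T f x)) -addrA.
apply: (le_trans (ler_normD _ _)).
have h1 := uf n.+1 x; rewrite exprS mulrCA in h1.
have h2 : `|T f x - u n.+1 x| <= q * (B * q ^+ n).
  by rewrite distrC; apply: contr => // y; exact: uf.
have : q * (B * q ^+ n) <= B * q ^+ n by rewrite ler_piMl ?ltW.
lra.
Unshelve. all: by end_near. Qed.

End UniformContraction.

(* Unification would otherwise unfold integrals when comparing real numbers. *)
Opaque sint primitive.

(** * Distance of densities with comparable ratio *)

Section ProbabilityDensities.
Context {R : realType}.
Implicit Types (f g : R -> R) (z s h x : R).

(** On the range [m1 <= f / g <= m2] the convex function [|f / g - 1|] lies below
    its chord.  Integrating the chord bounds the distance by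
    [2 (m2 - 1) (1 - m1) / (m2 - m1)], and for [m1 = z / s], [m2 = z s] the
    worst case is [z = 1]. *)
Lemma dist_ratio_bound f g z s : continuous f -> continuous g ->
  (forall x, 0 <= x <= 1 -> 0 < g x) ->
  sint 0 1 f = 1 -> sint 0 1 g = 1 -> 0 < z -> 1 < s ->
  (forall x, 0 <= x <= 1 -> z / s * g x <= f x <= z * s * g x) ->
  sint 0 1 (fun x => `|f x - g x|) * (s + 1) <= 2 * (s - 1).
Proof.
move=> cf cg g0 f1 g1 z0 s1 fg; have s0 : 0 < s by exact: lt_trans s1.
set m1 := z / s; set m2 := z * s.
have lf := continuous_locint cf; have lg := continuous_locint cg.
have m1_le1 : m1 <= 1.
  have : sint 0 1 (fun x => m1 * g x) <= sint 0 1 f.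
    by apply: le_sint => [||x /fg/andP[]//]; first exact: locintZ.
  by rewrite sintZ// f1 g1 mulr1.
have m2_ge1 : 1 <= m2.
  have : sint 0 1 f <= sint 0 1 (fun x => m2 * g x).
    by apply: le_sint => [||x /fg/andP[]//]; last exact: locintZ.
  by rewrite sintZ// f1 g1 mulr1.
have lX : locint (fun x => (m2 - 1) * (f x - m1 * g x)).
  by apply: locintZ; apply: locintB => //; exact: locintZ.
have lY : locint (fun x => (1 - m1) * (m2 * g x - f x)).
  by apply: locintZ; apply: locintB => //; exact: locintZ.
have lfg : locint (fun x => `|f x - g x|).
  by apply: locint_norm; exact: locintB.
have main : (m2 - m1) * sint 0 1 (fun x => `|f x - g x|) <= 2 * ((m2 - 1) * (1 - m1)).
  rewrite -sintZ//.
  apply: (@le_trans _ _ (sint 0 1 (fun x =>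
    (m2 - 1) * (f x - m1 * g x) + (1 - m1) * (m2 * g x - f x)))).
    apply: le_sint; [exact: locintZ|exact: locintD|].
    move=> x /fg/andP[fm1 fm2].
    set X := (m2 - 1) * _; set Y := (1 - m1) * _.
    have X0 : 0 <= X by rewrite mulr_ge0 ?subr_ge0.
    have Y0 : 0 <= Y by rewrite mulr_ge0 ?subr_ge0.
    have m12 : 0 <= m2 - m1 by lra.
    rewrite -[X in X * _]ger0_norm// -normrM.
    have -> : (m2 - m1) * (f x - g x) = X - Y by rewrite /X /Y; ring.
    by rewrite ler_norml; apply/andP; split; lra.
  rewrite sintD// !sintZ; last 2 first.
  - by apply: locintB => //; exact: locintZ.
  - by apply: locintB => //; exact: locintZ.
  rewrite !sintB ?sintZ//; [|exact: locintZ|exact: locintZ].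
  by rewrite f1 g1; lra.
set L := sint 0 1 _ in main *.
have {}main : L * (s ^+ 2 - 1) <= 2 * (s - 1) ^+ 2.
  have e1 : z * (L * (s ^+ 2 - 1)) = s * ((m2 - m1) * L).
    by rewrite /m1 /m2; field; exact: lt0r_neq0.
  have e2 : z * (2 * (s - 1) ^+ 2) =
      s * (2 * ((m2 - 1) * (1 - m1))) + 2 * s * (z - 1) ^+ 2.
    by rewrite /m1 /m2; field; exact: lt0r_neq0.
  rewrite -(ler_pM2l z0) e1 e2 -[leLHS]addr0 lerD//.
    by rewrite ler_pM2l.
  by rewrite mulr_ge0 ?sqr_ge0// mulr_ge0// ltW.
have s10 : 0 < s - 1 by rewrite subr_gt0.
rewrite -(ler_pM2r s10) (le_trans _ (le_trans main _))// le_eqVlt; apply/orP; left;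
  apply/eqP; ring.
Qed.

(** That is, [tanh (h / 2) <= h / 2]. *)
Lemma expR_tanh_le h : 0 <= h -> 2 * (expR h - 1) <= h * (expR h + 1).
Proof.
move=> h0; pose k (x : R) := x * (expR x + 1) - 2 * (expR x - 1).
have dk x : is_derive x 1 k (1 + (x - 1) * expR x).
  have de : is_derive x 1 expR (expR x) by exact: is_derive_expR.
  have dc (c : R) : is_derive x 1 (fun _ : R => c) 0 by exact: is_derive_cst.
  have d1 := is_derive_mul (is_derive_id x 1) (is_derive_add de (dc 1)).
  have d2 := is_derive_scale 2 (is_derive_sub de (dc 1)).
  by apply: is_derive_eq (is_derive_sub d1 d2) _; ring.
suff : k 0 <= k h by rewrite /k expR0; lra.
have ck := is_derive_cont dk.
apply: (@ger0_derive1_le_cc _ k 0 h) => //.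
- move=> x _; rewrite (is_derive_derive1 (dk x)).
  have := expR_ge1Dx (- x); rewrite -(ler_pM2r (expR_gt0 x)) -expRD addNr expR0; lra.
- exact: continuous_subspaceT.
- by rewrite in_itv/= lexx.
- by rewrite in_itv/= h0 lexx.
Qed.

End ProbabilityDensities.

(** * Gibbs densities *)

Section Gibbs.
Context {R : realType}.
Implicit Types (f G : R -> R) (tau g x y B : R).

Definition odd_periodic G :=
  [/\ continuous G, forall x, G (- x) = - G x & periodic G 2].

Lemma primitive_even G : continuous G -> (forall x, G (- x) = - G x) ->
  forall x, primitive G (- x) = primitive G x.
Proof.
move=> cG oG x; pose D x := primitive G (-1 * x + 0) - primitive G x.
have dD (y : R) : is_derive y 1 D 0.
  rewrite (_ : 0 = G (-1 * y + 0) * -1 - G y); last by rewrite addr0 mulN1r oG; ring.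
  by apply: is_derive_sub; [apply: is_derive_affine|]; exact: is_derive_primitive.
have := @is_derive_0_is_cst R D x 0 dD.
rewrite /D !addr0 mulr0 subrr mulN1r => /eqP.
by rewrite subr_eq0 => /eqP.
Qed.

(** An odd function has mean zero over a period, so its primitive is periodic. *)
Lemma primitive_periodic G : odd_periodic G -> periodic (primitive G) 2.
Proof.
move=> [cG oG pG] x; pose D x := primitive G (x + 2) - primitive G x.
have dD (y : R) : is_derive y 1 D 0.
  rewrite (_ : 0 = G (y + 2) - G y); last by rewrite pG subrr.
  by apply: is_derive_sub; [apply: is_derive_translate|]; exact: is_derive_primitive.
have := @is_derive_0_is_cst R D x (-1) dD.
rewrite /D (_ : -1 + 2 = 1 :> R); last by lra.
by rewrite primitive_even// subrr => /eqP; rewrite subr_eq0 => /eqP.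
Qed.

Definition potential tau G x : R := 2 / tau * primitive G x.

Definition partition_function tau G : R := sint 0 1 (fun x => expR (- potential tau G x)).

Definition gibbs tau G x : R := expR (- potential tau G x) / partition_function tau G.

Lemma is_derive_potential tau G x : continuous G ->
  is_derive x 1 (potential tau G) (2 / tau * G x).
Proof. by move=> cG; apply: is_derive_scale; exact: is_derive_primitive. Qed.

Lemma continuous_boltzmann tau G : continuous G ->
  continuous (fun x => expR (- potential tau G x)).
Proof.
move=> cG; apply: cont_comp; first exact: continuous_expR.
have dV x := is_derive_potential tau x cG.
exact: (cont_opp (is_derive_cont dV)).
Qed.

Lemma sint01_gt0 f : continuous f -> (forall x, 0 < f x) -> 0 < sint 0 1 f.
Proof.
move=> cf f0.
have [c _ cmin] : exists2 c, c \in `[0, 1]%R & forall t, t \in `[0, 1]%R -> f c <= f t.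
  by apply: EVT_min => //; exact: continuous_subspaceT.
apply: (lt_le_trans (f0 c)).
rewrite -[X in X <= _]mulr1 -[X in _ * X <= _]subr0 -sint_cst//.
apply: le_sint; [exact/continuous_locint/cont_cst|exact: continuous_locint|].
by move=> x x01; apply: cmin; rewrite in_itv.
Qed.

Lemma partition_function_gt0 tau G : continuous G -> 0 < partition_function tau G.
Proof.
by move=> cG; apply: sint01_gt0 => [|x]; [exact: continuous_boltzmann|exact: expR_gt0].
Qed.

Lemma gibbs_gt0 tau G x : continuous G -> 0 < gibbs tau G x.
Proof. by move=> cG; rewrite divr_gt0 ?expR_gt0// partition_function_gt0. Qed.

Lemma continuous_gibbs tau G : continuous G -> continuous (gibbs tau G).
Proof.
by move=> cG; apply: cont_mul; [exact: continuous_boltzmann|exact: cont_cst].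
Qed.

Lemma gibbs_mass tau G : continuous G -> sint 0 1 (gibbs tau G) = 1.
Proof.
move=> cG; have p0 := partition_function_gt0 tau cG.
rewrite (@eq_sint _ _ _ _ (fun x => (partition_function tau G)^-1 * expR (- potential
  tau G x))); last first.
  by move=> x _; rewrite mulrC.
rewrite sintZ; last by apply: continuous_locint; exact: continuous_boltzmann.
by rewrite mulVf//; exact: lt0r_neq0.
Qed.

Lemma is_derive_gibbs tau G x : continuous G ->
  is_derive x 1 (gibbs tau G) (- (2 / tau * G x) * gibbs tau G x).
Proof.
move=> cG; have dV : is_derive x 1 (fun y => - potential tau G y) (- (2 / tau * G x)).
  by apply: is_deriveN; exact: is_derive_potential.
have dE := @is_derive1_comp _ expR _ x _ _ (is_derive_expR _) dV.
rewrite (_ : gibbs tau G = fun y => (partition_function tau G)^-1 * expR (- potential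
  tau G y)); last first.
  by apply/funext => y; rewrite mulrC.
by apply: is_derive_eq (is_derive_scale _ dE) _; rewrite mulrA [in RHS]mulrC.
Qed.

Lemma even_periodic_gibbs tau G : odd_periodic G -> even_periodic (gibbs tau G).
Proof.
move=> oG; have [cG odG pG] := oG; split=> x; rewrite /gibbs /potential.
  by rewrite primitive_even.
by rewrite primitive_periodic.
Qed.

Lemma primitive_lipschitz G B x y : continuous G -> 0 <= B -> (forall t, `|G t| <= B) ->
  `|primitive G x - primitive G y| <= B * `|x - y|.
Proof.
move=> cG B0 GB; wlog yx : x y / y <= x.
  move=> H; case: (leP y x) => [/H//|/ltW/H].
  by rewrite distrC (distrC y).
have lG := continuous_locint cG.
rewrite -sint_primitive// (ger0_norm (x := x - y)) ?subr_ge0//.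
apply: (le_trans (ler_norm_sint _ _ lG)).
rewrite -(sint_cst B yx); apply: le_sint => //; first exact: locint_norm.
exact/continuous_locint/cont_cst.
Qed.

(** The normalisation cancels in the quotient of two values, and the potential
    oscillates by at most [2 B / tau] over [0, 1]. *)
Lemma gibbs_harnack tau G B x y : 0 < tau -> continuous G -> (forall t, `|G t| <= B) ->
  0 <= x <= 1 -> 0 <= y <= 1 ->
  gibbs tau G x <= expR (2 * B / tau) * gibbs tau G y.
Proof.
move=> tau0 cG GB x01 y01; have B0 : 0 <= B by exact: le_trans (GB 0).
rewrite /gibbs mulrA ler_pM2r ?invr_gt0 ?partition_function_gt0// -expRD ler_expR /potential.
have := primitive_lipschitz y x cG B0 GB.
have yx1 : `|y - x| <= 1 by rewrite ler_norml; apply/andP; split; lra.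
move=> /le_trans/(_ (ler_wpM2l B0 yx1)); rewrite mulr1 => /ler_normlW H.
have taui : 0 < 2 / tau by rewrite divr_gt0.
move: H; rewrite -(ler_pM2l taui) mulrBr [2 * B / tau]mulrAC; lra.
Qed.

Lemma gibbs_bounds tau G B x : 0 < tau -> continuous G -> (forall t, `|G t| <= B) ->
  0 <= x <= 1 -> expR (- (2 * B / tau)) <= gibbs tau G x <= expR (2 * B / tau).
Proof.
move=> tau0 cG GB x01; have lg := continuous_locint (@continuous_gibbs tau _ cG).
have lc c : locint (fun _ : R => c) by exact/continuous_locint/cont_cst.
have cst c : sint 0 1 (fun _ : R => c) = c by rewrite sint_cst// subr0 mulr1.
set E := expR (2 * B / tau); have E0 : 0 < E by exact: expR_gt0.
apply/andP; split.
  have : sint 0 1 (gibbs tau G) <= sint 0 1 (fun _ => E * gibbs tau G x).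
    apply: le_sint; [exact: lg|exact: lc|] => y y01.
    exact: (gibbs_harnack tau0 cG GB).
  rewrite gibbs_mass// cst => H.
  by rewrite expRN -/E -[X in X <= _]mulr1 ler_pdivrMl.
have : sint 0 1 (fun _ => gibbs tau G x) <= sint 0 1 (fun y => E * gibbs tau G y).
  apply: le_sint; [exact: lc|exact: locintZ|] => y y01.
  exact: (gibbs_harnack tau0 cG GB).
by rewrite cst sintZ// gibbs_mass// mulr1.
Qed.

(** The difference [D] of the potentials is compared with its value at the
    midpoint: over [0, 1] it moves away from it by at most [h = g / tau], half of
    its possible oscillation.  The ratio of the densities thus stays within a
    factor [exp h] of a constant [z], and the previous bounds give
    [2 tanh (h / 2) <= h]. *)
Lemma gibbs_contraction tau G1 G2 g : 0 < tau -> continuous G1 -> continuous G2 ->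
  0 < g -> (forall x, `|G1 x - G2 x| <= g) ->
  sint 0 1 (fun x => `|gibbs tau G1 x - gibbs tau G2 x|) <= g / tau.
Proof.
move=> tau0 c1 c2 g0 G12.
have alg (a b c p1 p2 : R) : 0 < p1 -> 0 < p2 ->
    a * (b * c) / p1 = a * (p2 / p1) * b * (c / p2).
  by move=> p10 p20; field; rewrite (lt0r_neq0 p10) (lt0r_neq0 p20).
pose h := g / tau; pose s := expR h.
have h0 : 0 < h by exact: divr_gt0.
have s1 : 1 < s by rewrite expR_gt1.
have Z1 := partition_function_gt0 tau c1; have Z2 := partition_function_gt0 tau c2.
pose D x := potential tau G1 x - potential tau G2 x.
pose z := expR (- D (2^-1)) * (partition_function tau G2 / partition_function tau G1).
have z0 : 0 < z by exact: (mulr_gt0 (expR_gt0 _) (divr_gt0 Z2 Z1)).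
have l1 := continuous_locint c1; have l2 := continuous_locint c2.
have Dosc x : 0 <= x <= 1 -> - h <= D x - D (2^-1) <= h.
  case/andP=> x0 x1; rewrite -ler_norml.
  have cG12 : continuous (fun t => G1 t - G2 t) by exact: cont_sub.
  have pE u v : u <= v -> primitive G1 v - primitive G2 v - (primitive G1 u - primitive G2 u) =
      primitive (fun t => G1 t - G2 t) v - primitive (fun t => G1 t - G2 t) u.
    move=> uv; rewrite -(sint_primitive (continuous_locint cG12) uv) (sintB _ _ l1 l2).
    by rewrite (sint_primitive l1 uv) (sint_primitive l2 uv); ring.
  have pE' : primitive G1 x - primitive G2 x - (primitive G1 2^-1 - primitive G2 2^-1) =
      primitive (fun t => G1 t - G2 t) x - primitive (fun t => G1 t - G2 t) 2^-1.
    case: (leP 2^-1 x) => [le|/ltW le]; first exact: (pE _ _ le).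
    by apply: oppr_inj; rewrite [LHS]opprB [RHS]opprB; exact: (pE _ _ le).
  have -> : D x - D 2^-1 = 2 / tau * (primitive (fun t => G1 t - G2 t) x -
      primitive (fun t => G1 t - G2 t) 2^-1).
    by rewrite -pE' /D /potential; ring.
  rewrite normrM gtr0_norm ?divr_gt0//.
  have -> : h = 2 / tau * (g * 2^-1) by rewrite /h; field; exact: lt0r_neq0.
  rewrite ler_pM2l ?divr_gt0//.
  apply: (le_trans (primitive_lipschitz _ _ cG12 (ltW g0) G12)).
  rewrite (ler_pM2l g0) ler_norml; clear -x0 x1; apply/andP; split; lra.
have ratio x : 0 <= x <= 1 ->
    z / s * gibbs tau G2 x <= gibbs tau G1 x <= z * s * gibbs tau G2 x.
  move=> /Dosc/andP[hD Dh].
  have E : gibbs tau G1 x = z * expR (D 2^-1 - D x) * gibbs tau G2 x.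
    have VE : - potential tau G1 x = - D 2^-1 + ((D 2^-1 - D x) - potential tau G2 x).
      by rewrite [D x]/D; ring.
    by rewrite /gibbs VE (expRD (- D 2^-1)) (expRD (D 2^-1 - D x)); exact: alg.
  have g2 : 0 < gibbs tau G2 x by exact: gibbs_gt0.
  rewrite E !(ler_pM2r g2) !(ler_pM2l z0) /s -expRN !ler_expR.
  by clear -hD Dh; apply/andP; split; lra.
have := @dist_ratio_bound _ _ _ z s (@continuous_gibbs tau _ c1) (@continuous_gibbs tau _ c2)
  (fun x _ => gibbs_gt0 tau x c2) (gibbs_mass tau c1) (gibbs_mass tau c2) z0 s1 ratio.
have := expR_tanh_le (ltW h0); rewrite -/s -/h => H1 /le_trans/(_ H1).
by rewrite ler_pM2r// addr_gt0// (lt_trans _ s1).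
Qed.

End Gibbs.

(** * Existence of a stationary drift *)

Section StationaryDrift.
Context {R : realType}.
Implicit Types (f G rho : R -> R) (r M tau x : R).

Definition density f :=
  [/\ locint f, even_periodic f, forall x, 0 <= f x & sint 0 1 f = 1].

Lemma density_gibbs tau G : odd_periodic G -> density (gibbs tau G).
Proof.
move=> oG; have [cG _ _] := oG; split.
- exact/continuous_locint/continuous_gibbs.
- exact: even_periodic_gibbs.
- by move=> x; apply: ltW; exact: gibbs_gt0.
- exact: gibbs_mass.
Qed.

Lemma locint_mix M f rho : locint f -> locint rho ->
  locint (fun y => rho y + M * f y).
Proof. by move=> lf lrho; apply: locintD => //; exact: locintZ. Qed.

Lemma drift_odd_periodic r M f rho : 0 <= r -> density f -> density rho ->
  odd_periodic (drift r M f rho).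
Proof.
move=> r0 [lf [ef pf] _ _] [lrho [erho prho] _ _].
have l := locint_mix M lf lrho; split.
- exact: continuous_conv_w.
- by move=> x; apply: conv_w_odd => // y; rewrite ef erho.
- by apply: conv_w_periodic => // y; rewrite pf prho.
Qed.

Lemma drift_bound r M f rho x : 0 <= r -> 0 <= M -> density f -> density rho ->
  `|drift r M f rho x| <= 2 * r * (1 + M).
Proof.
move=> r0 M0 [lf [ef pf] f0 f1] [lrho [erho prho] rho0 rho1].
have l := locint_mix M lf lrho.
rewrite (_ : 2 * r * (1 + M) = r * sint (-1) 1 (fun y => rho y + M * f y)).
  apply: conv_w_bound_ge0 => // y; first by rewrite pf prho.
  exact: (addr_ge0 (rho0 y) (mulr_ge0 M0 (f0 y))).
rewrite sint_even//; last by move=> y; rewrite ef erho.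
by rewrite sintD ?sintZ// ?rho1 ?f1; [ring|exact: locintZ].
Qed.

Lemma drift_diff r M f rho1 rho2 x : locint f -> locint rho1 -> locint rho2 ->
  drift r M f rho1 x - drift r M f rho2 x =
  conv_w r (fun y => rho1 y - rho2 y) x.
Proof.
move=> lf l1 l2; rewrite /drift -conv_wB; [|exact: locint_mix..].
by congr conv_w; apply/funext => y; ring.
Qed.

Lemma drift_lipschitz r M f rho1 rho2 x : 0 <= r -> density f ->
  density rho1 -> density rho2 ->
  `|drift r M f rho1 x - drift r M f rho2 x| <=
  2 * r * sint 0 1 (fun y => `|rho1 y - rho2 y|).
Proof.
move=> r0 [lf _ _ _] [l1 [e1 p1] _ _] [l2 [e2 p2] _ _]; rewrite drift_diff//.
have l12 : locint (fun y => rho1 y - rho2 y) by exact: locintB.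
apply: (le_trans (conv_w_bound x r0 l12 _)); first by move=> y; rewrite p1 p2.
rewrite sint_even; [|exact: locint_norm|by move=> y; rewrite e1 e2].
by rewrite le_eqVlt; apply/orP; left; apply/eqP; ring.
Qed.

(** The closure property required by Picard iteration. *)
Lemma odd_periodic_uniform_limit (u : nat -> R -> R) G :
  (forall n, odd_periodic (u n)) ->
  (forall e : R, 0 < e -> exists n, forall x, `|u n x - G x| <= e) ->
  odd_periodic G.
Proof.
move=> ou lim.
have eq0 (a : R) : (forall e : R, 0 < e -> `|a| <= e) -> a = 0.
  move=> ha; apply/eqP; rewrite -normr_le0; apply/ler_addgt0Pr => e e0.
  by rewrite add0r; exact: ha.
split.
- move=> x; apply/cvgrPdist_le => e e0.
  have [n un] := lim (e / 3) (divr_gt0 e0 (ltr0n _ 3)).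
  have [cu _ _] := ou n.
  have := cu x; move=> /cvgrPdist_le/(_ (e / 3) (divr_gt0 e0 (ltr0n _ 3))).
  apply: filterS => y uxy; have ux := un x; have uy := un y.
  rewrite (_ : G x - G y = - (u n x - G x) + (u n x - u n y) + (u n y - G y)); last by ring.
  apply: (le_trans (ler_normD _ _)); apply: (le_trans (lerD (ler_normD _ _) (lexx _))).
  rewrite normrN; lra.
- move=> x; apply/eqP; rewrite -subr_eq0; apply/eqP; apply: eq0 => e e0.
  have [n un] := lim (e / 2) (divr_gt0 e0 (ltr0n _ 2)).
  have [_ odu _] := ou n; have ux := un x; have uy := un (- x).
  rewrite (_ : G (- x) - - G x = - (u n (- x) - G (- x)) - (u n x - G x));
    last by rewrite odu; ring.
  by apply: (le_trans (ler_normB _ _)); rewrite normrN; lra.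
- move=> x; apply/eqP; rewrite -subr_eq0; apply/eqP; apply: eq0 => e e0.
  have [n un] := lim (e / 2) (divr_gt0 e0 (ltr0n _ 2)).
  have [_ _ pu] := ou n; have ux := un x; have uy := un (x + 2).
  rewrite (_ : G (x + 2) - G x = (u n x - G x) - (u n (x + 2) - G (x + 2)));
    last by rewrite pu; ring.
  by apply: (le_trans (ler_normB _ _)); lra.
Qed.

(** Composing [drift_lipschitz] and [gibbs_contraction] shows that the map has
    Lipschitz constant [2 r / tau]. *)
Lemma stationary_drift r M tau f : 0 < r -> 0 <= M -> 2 * r < tau -> density f ->
  exists2 G, odd_periodic G & forall x, drift r M f (gibbs tau G) x = G x.
Proof.
move=> r0 M0 rtau df; have tau0 : 0 < tau by apply: (lt_trans _ rtau); rewrite mulr_gt0.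
have lf : locint f by case: df.
apply: (@uniform_contraction_fixpoint R odd_periodic
  (fun G => drift r M f (gibbs tau G)) (2 * r / tau) (2 * r * (1 + M)) (fun _ => 0)).
- by rewrite divr_gt0 ?mulr_gt0// ltr_pdivrMr// mul1r.
- by rewrite mulr_gt0 ?mulr_gt0//; lra.
- by move=> G oG; exact: (drift_odd_periodic M (ltW r0) df (density_gibbs tau oG)).
- move=> G1 G2 c o1 o2 c0 G12 x.
  have [c1 _ _] := o1; have [c2 _ _] := o2.
  apply: (le_trans (drift_lipschitz M x (ltW r0) df (density_gibbs tau o1)
    (density_gibbs tau o2))).
  have := gibbs_contraction tau0 c1 c2 c0 G12.
  have r20 : 0 < 2 * r by rewrite mulr_gt0.
  rewrite -(ler_pM2l r20) => H; apply: (le_trans H).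
  by rewrite le_eqVlt; apply/orP; left; apply/eqP; ring.
- exact: odd_periodic_uniform_limit.
- by split => [|x|x]; [exact: cont_cst|rewrite oppr0|].
- move=> x; rewrite subr0.
  have o0 : odd_periodic (fun _ : R => 0).
    by split => [|y|y]; [exact: cont_cst|rewrite oppr0|].
  exact: (@drift_bound r M f _ x (ltW r0) M0 df (density_gibbs tau o0)).
Qed.

End StationaryDrift.

(** * The dissipation inequality *)

Section Dissipation.
Context {R : realType}.
Implicit Types (f G p v dv w : R -> R) (r M tau x : R).

Lemma even_derive_odd v dv : (forall x, v (- x) = v x) ->
  (forall x, is_derive x 1 v (dv x)) -> forall x, dv (- x) = - dv x.
Proof.
move=> ev dvE x.
have d1 : is_derive x 1 (fun y => v (-1 * y + 0)) (dv (-1 * x + 0) * -1).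
  exact: is_derive_affine.
rewrite addr0 mulN1r (_ : (fun y => _) = v) in d1; last first.
  by apply/funext => y; rewrite addr0 mulN1r ev.
have := is_derive_derive1 d1; rewrite (is_derive_derive1 (dvE x)) => ->; ring.
Qed.

Lemma periodic_derive v dv : periodic v 2 ->
  (forall x, is_derive x 1 v (dv x)) -> periodic dv 2.
Proof.
move=> pv dvE x.
have d1 : is_derive x 1 (fun y => v (y + 2)) (dv (x + 2)) by exact: is_derive_translate.
rewrite (_ : (fun y => _) = v) in d1; last by apply/funext => y; rewrite pv.
by have := is_derive_derive1 d1; rewrite (is_derive_derive1 (dvE x)) => ->.
Qed.

Lemma odd_periodic_0 v : (forall x, v (- x) = - v x) -> v 0 = 0.
Proof. by move=> ov; have := ov 0; rewrite oppr0; lra. Qed.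

Lemma odd_periodic_1 v : (forall x, v (- x) = - v x) -> periodic v 2 -> v 1 = 0.
Proof.
move=> ov pv; have := pv (-1); rewrite (_ : -1 + 2 = 1 :> R); last by lra.
rewrite ov; lra.
Qed.

(** The first summand bounds the drift of the solution.  The second one bounds the
    operator [psi |-> p (w * psi)] in [L^2]; its shape comes from
    [r (r + 1) E^2 <= (r E^4 + 1 / 2)^2] with [E = exp (2 r (1 + M) / tau) >= 1]. *)
Definition drift_cost r M tau : R :=
  2 * r * (1 + M) +
  2 / Num.sqrt 3 * r * (r * expR (8 * r * (1 + M) / tau) + 2^-1).

(** What is left of the coefficient [tau / 2] of the dissipation once the cost,
    divided by the Poincare constant, has been absorbed. *)
Definition dissipation_rate r M tau : R := tau / 2 - drift_cost r M tau / pi.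

Definition noise_dominates r M tau :=
  4 * r * (3 + M) / pi + 4 * r ^+ 2 / (pi * Num.sqrt 3) * expR (8 * r * (1 + M) / tau)
  < tau.

Lemma sqrt3_ge1 : 1 <= Num.sqrt 3 :> R.
Proof. by rewrite -[leLHS]sqrtr1 ler_sqrt ?ler1n ?ltr0n. Qed.

(** The summand [8 r / pi] hidden in [4 r (3 + M) / pi] pays for the term
    [1 / 2] of the cost. *)
Lemma dissipation_rate_gt0 r M tau : 0 < r -> noise_dominates r M tau ->
  0 < dissipation_rate r M tau.
Proof.
move=> r0; rewrite /noise_dominates /dissipation_rate /drift_cost.
move: (expR _) => E; have := sqrt3_ge1; move: (Num.sqrt 3) => c c1.
have c0 : 0 < c by exact: lt_le_trans c1.
have pi0 := pi_gt0 R; move: pi pi0 => P P0.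
have -> : 4 * r * (3 + M) / P + 4 * r ^+ 2 / (P * c) * E =
  (4 * r * (3 + M) + 4 * r ^+ 2 * E / c) / P.
  by field; rewrite (lt0r_neq0 c0) (lt0r_neq0 P0).
have -> : tau / 2 - (2 * r * (1 + M) + 2 / c * r * (r * E + 2^-1)) / P =
  ((tau * P - (4 * r * (3 + M) + 4 * r ^+ 2 * E / c)) / 2 + (4 * r - r / c)) / P.
  by field; rewrite (lt0r_neq0 c0) (lt0r_neq0 P0).
rewrite ltr_pdivrMr// => H; apply: divr_gt0 => //.
have : r / c <= r by rewrite ler_pdivrMr// ler_peMr// ltW.
lra.
Qed.

(** As [pi < 4], already [4 r (3 + M) / pi] exceeds [2 r]. *)
Lemma noise_dominates_2r r M tau : 0 < r -> 0 <= M -> noise_dominates r M tau -> 2 * r < tau.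
Proof.
move=> r0 M0; rewrite /noise_dominates; apply: le_lt_trans.
have E0 := expR_ge0 (8 * r * (1 + M) / tau); move: (expR _) E0 => E E0.
have a1 : 0 <= 4 * r ^+ 2 := mulr_ge0 (ler0n _ 4) (sqr_ge0 r).
have a2 : 0 <= pi * Num.sqrt 3 := mulr_ge0 (pi_ge0 R) (sqrtr_ge0 3).
have h2 := mulr_ge0 (divr_ge0 a1 a2) E0.
suff : 2 * r <= 4 * r * (3 + M) / pi by lra.
rewrite ler_pdivlMr ?pi_gt0//.
have pi4 : pi < 4 :> R by have := pihalf_lt2 R; lra.
have : 2 * r * pi <= 2 * r * 4 by rewrite ler_pM2l ?mulr_gt0// ltW.
have : 0 <= r * M by rewrite mulr_ge0// ltW.
lra.
Qed.

Lemma young_inequality (th a b : R) : 0 < th -> a * b <= 2^-1 * (th * a ^+ 2 + b ^+ 2 / th).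
Proof.
move=> th0; rewrite -subr_ge0.
have -> : 2^-1 * (th * a ^+ 2 + b ^+ 2 / th) - a * b = (th * a - b) ^+ 2 / (2 * th).
  by field; exact: lt0r_neq0.
by rewrite divr_ge0 ?sqr_ge0// mulr_ge0// ltW.
Qed.

(** Testing the equation with [psi = v - p] and integrating by parts leaves
    [- psi_x (J - J_p)], where [J] is the total flux of [v] and the total flux
    [J_p] of the Gibbs density [p] vanishes.  The products are split by weighted
    Young inequalities whose weights make both resulting terms comparable under
    the Poincare inequality. *)
Lemma dissipation r M tau f G v dv w :
  0 < r -> 0 <= M -> 0 < tau -> density f ->
  odd_periodic G -> (forall x, drift r M f (gibbs tau G) x = G x) ->
  density v -> (forall x, is_derive x 1 v (dv x)) -> continuous dv ->
  (forall x, is_derive x 1 (fun y => flux r M f v y + tau / 2 * dv y) (w x)) ->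
  continuous w ->
  sint 0 1 (fun x => (v x - gibbs tau G x) * w x) <=
  - dissipation_rate r M tau *
    sint 0 1 (fun x => (dv x - - (2 / tau * G x) * gibbs tau G x) ^+ 2) /\
  pi ^+ 2 * sint 0 1 (fun x => (v x - gibbs tau G x) ^+ 2) <=
    sint 0 1 (fun x => (dv x - - (2 / tau * G x) * gibbs tau G x) ^+ 2).
Proof.
move=> r0 M0 tau0 df oG GE dens_v dvE cdv dJ cw.
have [lv [ev pv] v0 v1] := dens_v; have [cG odG pG] := oG.
set p := gibbs tau G; pose dp x := - (2 / tau * G x) * p x.
have dens_p : density p := density_gibbs tau oG.
have [lp [ep pp] _ p1] := dens_p.
have dpE x : is_derive x 1 p (dp x) by exact: is_derive_gibbs.
have cp : continuous p := is_derive_cont dpE.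
have cv : continuous v := is_derive_cont dvE.
have cdp : continuous dp.
  apply: cont_mul => //; apply: cont_opp.
  by apply: cont_mul => //; exact: cont_cst.
pose psi x := v x - p x; pose dpsi x := dv x - dp x.
have psiE x : is_derive x 1 psi (dpsi x) by exact: is_derive_sub.
have cpsi : continuous psi := is_derive_cont psiE.
have cdpsi : continuous dpsi by exact: cont_sub.
have lpsi2 := continuous_locint (cont_sqr cpsi).
have ldpsi2 := continuous_locint (cont_sqr cdpsi).
pose Gv := drift r M f v.
have [cGv oGv pGv] : odd_periodic Gv := drift_odd_periodic M (ltW r0) df dens_v.
pose J y := flux r M f v y + tau / 2 * dv y.
have cJ : continuous J := is_derive_cont dJ.
set n := sint 0 1 (fun x => psi x ^+ 2); set d := sint 0 1 (fun x => dpsi x ^+ 2).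
have poincare : pi ^+ 2 * n <= d.
  apply: neumann_poincare psiE cdpsi _.
  by rewrite sintB// v1 p1 subrr.
split; last exact: poincare.
(* The total flux is odd and periodic, so there are no boundary terms. *)
have odv := even_derive_odd ev dvE.
have pdv := periodic_derive pv dvE.
have J0 : J 0 = 0.
  by rewrite /J /flux -/(Gv 0) (odd_periodic_0 oGv) (odd_periodic_0 odv) !mulr0 addr0.
have J1 : J 1 = 0.
  by rewrite /J /flux -/(Gv 1) (odd_periodic_1 oGv pGv) (odd_periodic_1 odv pdv) !mulr0 addr0.
have parts : sint 0 1 (fun x => psi x * w x) = - sint 0 1 (fun x => dpsi x * J x).
  have dpJ x : is_derive x 1 (fun y => psi y * J y) (dpsi x * J x + psi x * w x).
    exact: (is_derive_mul (psiE x) (dJ x)).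
  have cdJ := cont_mul cdpsi cJ; have cpw := cont_mul cpsi cw.
  have ends (a b a' b' : R) : b = 0 -> b' = 0 -> a * b - a' * b' = 0.
    by move=> -> ->; rewrite !mulr0 subrr.
  have := etrans (sint_derive dpJ (cont_add cdJ cpw) ler01) (ends _ _ _ _ J1 J0).
  rewrite (sintD _ _ (continuous_locint cdJ) (continuous_locint cpw)).
  by move=> /eqP; rewrite addrC addr_eq0 => /eqP.
rewrite -/p -/psi -/dp -/dpsi -/d parts.
pose c := conv_w r psi.
have cc : continuous c by apply: continuous_conv_w (ltW r0) (continuous_locint cpsi).
have JE x : J x = psi x * Gv x + p x * c x + tau / 2 * dpsi x.
  have lf : locint f by case: df.
  have -> : c x = Gv x - G x by rewrite /c -GE /Gv drift_diff.
  by rewrite /J /flux -/(Gv x) /psi /dpsi /dp; field; exact: lt0r_neq0.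
set B := 2 * r * (1 + M).
have GvB x : `|Gv x| <= B := @drift_bound _ r M f v x (ltW r0) M0 df dens_v.
have B0 : 0 <= B by apply: (le_trans _ (GvB 0)).
set E2 := expR (2 * B / tau).
have pE2 x : 0 <= x <= 1 -> 0 <= p x <= E2.
  move=> x01; have GB t : `|G t| <= B.
    by rewrite -GE; exact: (@drift_bound _ r M f p t (ltW r0) M0 df dens_p).
  have /andP[_ ->] := gibbs_bounds tau0 cG GB x01.
  by rewrite ltW// gibbs_gt0.
have E21 : 1 <= E2.
  rewrite -[leLHS]expR0 ler_expR.
  exact: (divr_ge0 (mulr_ge0 (ler0n _ 2) B0) (ltW tau0)).
have E4E : expR (8 * r * (1 + M) / tau) = E2 ^+ 2.
  by rewrite /E2 -expRM_natl; congr expR; rewrite /B; ring.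
set q := 2 / Num.sqrt 3 * r * (r * E2 ^+ 2 + 2^-1).
have c30 : 0 < Num.sqrt 3 :> R by exact: lt_le_trans sqrt3_ge1.
have c32 : Num.sqrt 3 ^+ 2 = 3 :> R by rewrite sqr_sqrtr.
have q0 : 0 < q.
  rewrite /q mulr_gt0 ?mulr_gt0 ?invr_gt0//.
  by rewrite addr_gt0// mulr_gt0// exprn_gt0// (lt_le_trans _ E21).
have pi0 := pi_gt0 R.
set S := 2 / 3 * r ^+ 3 * ((r + 1) * (2 * n)).
have n0 : 0 <= n by apply: sint_ge0 => x _; exact: sqr_ge0.
have cS x : c x ^+ 2 <= S.
  have ppsi : periodic psi 2 by move=> y; rewrite /psi pv pp.
  have epsi2 y : psi (- y) ^+ 2 = psi y ^+ 2 by rewrite /psi ev ep.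
  by rewrite /S /n -(sint_even lpsi2 epsi2); exact: (conv_w_sqr_bound _ (ltW r0) cpsi ppsi).
have SE : S * E2 <= q ^+ 2 * n.
  rewrite /S /q -subr_ge0.
  have -> : (2 / Num.sqrt 3 * r * (r * E2 ^+ 2 + 2^-1)) ^+ 2 * n -
    2 / 3 * r ^+ 3 * ((r + 1) * (2 * n)) * E2 =
    4 / 3 * r ^+ 2 * n * (r ^+ 2 * E2 * (E2 ^+ 3 - 1) + r * E2 * (E2 - 1) + 4^-1).
    rewrite (_ : (2 / Num.sqrt 3 * r * (r * E2 ^+ 2 + 2^-1)) ^+ 2 =
      4 / (Num.sqrt 3 ^+ 2) * r ^+ 2 * (r * E2 ^+ 2 + 2^-1) ^+ 2); last first.
      by field; exact: lt0r_neq0.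
    by rewrite c32; field.
  have E20 : 0 <= E2 by exact: le_trans E21.
  have E3 : 1 <= E2 ^+ 3 by rewrite exprn_ege1.
  apply: mulr_ge0; first by rewrite mulr_ge0// mulr_ge0// sqr_ge0.
  apply: addr_ge0 => //; apply: addr_ge0; apply: mulr_ge0; rewrite ?subr_ge0//.
    by rewrite mulr_ge0// sqr_ge0.
  by rewrite mulr_ge0// ltW.
have th0 : 0 < q / pi by exact: divr_gt0.
pose bnd x := B * (2^-1 * (pi^-1 * dpsi x ^+ 2 + pi * psi x ^+ 2)) +
  2^-1 * (q / pi * dpsi x ^+ 2 + S * E2 / (q / pi) * p x) - tau / 2 * dpsi x ^+ 2.
(* The weights [1 / pi] and [q / pi] are those for which the Poincare inequality
   balances the two squares. *)
have ptw x : 0 <= x <= 1 -> - (dpsi x * J x) <= bnd x.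
  move=> /pE2/andP[px0 pxE]; rewrite JE /bnd.
  have t1 : - (dpsi x * (psi x * Gv x)) <=
      B * (2^-1 * (pi^-1 * dpsi x ^+ 2 + pi * psi x ^+ 2)).
    apply: (le_trans (ler_norm _)); rewrite normrN !normrM mulrA [leLHS]mulrC.
    apply: ler_pM; [exact: normr_ge0|exact: (mulr_ge0 (normr_ge0 _) (normr_ge0
      _))|exact: GvB|].
    have pii0 : 0 < pi^-1 :> R by rewrite invr_gt0.
    have := young_inequality `|dpsi x| `|psi x| pii0.
    by rewrite !real_normK ?num_real// invrK [pi * _]mulrC.
  have t2 : - (dpsi x * (p x * c x)) <=
      2^-1 * (q / pi * dpsi x ^+ 2 + S * E2 / (q / pi) * p x).
    apply: (@le_trans _ _ (2^-1 * (q / pi * dpsi x ^+ 2 + (- (p x * c x)) ^+ 2 / (q / pi)))).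
      by rewrite -mulrN; exact: young_inequality.
    have pp2 : p x ^+ 2 <= E2 * p x by rewrite expr2; exact: ler_wpM2r.
    have half0 : 0 < 2^-1 :> R by rewrite invr_gt0 ltr0n.
    rewrite (ler_pM2l half0) lerD2l [leRHS]mulrAC sqrrN exprMn ler_wpM2r//.
      by rewrite invr_ge0 ltW.
    rewrite [leLHS]mulrC -[leRHS]mulrA.
    exact: (ler_pM (sqr_ge0 _) (sqr_ge0 _) (cS x) pp2).
  by move: t1 t2; set a1 := dpsi x * _; set a2 := dpsi x * _; rewrite /a1 /a2; lra.
have lbnd1 : locint (fun x => pi^-1 * dpsi x ^+ 2 + pi * psi x ^+ 2).
  by apply: locintD; exact: locintZ.
have lbnd2 : locint (fun x => q / pi * dpsi x ^+ 2 + S * E2 / (q / pi) * p x).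
  by apply: locintD; exact: locintZ.
have ldJ := continuous_locint (cont_mul cdpsi cJ).
rewrite -mulN1r -sintZ//.
apply: (@le_trans _ _ (sint 0 1 bnd)).
  apply: le_sint.
  - exact: locintZ.
  - apply: locintB; last exact: locintZ.
    by apply: locintD; apply: locintZ => //; exact: locintZ.
  - by move=> x /ptw; rewrite mulN1r.
rewrite /bnd sintB; [|by apply: locintD; apply: locintZ => //; exact: locintZ|exact: locintZ].
rewrite sintD; [|by apply: locintZ; exact: locintZ|exact: locintZ].
rewrite !sintZ//; [|exact: locintZ].
rewrite !sintD ?sintZ//; [|exact: locintZ..].
rewrite -/n -/d p1 mulr1.
have e1 : B * (2^-1 * (pi^-1 * d + pi * n)) <= B * (d / pi).
  rewrite ler_wpM2l//.
  have : pi * n <= d / pi by rewrite ler_pdivlMr// mulrAC -expr2.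
  by rewrite [pi^-1 * d]mulrC; lra.
have e2 : S * E2 / (q / pi) <= q * (d / pi).
  rewrite ler_pdivrMr//; apply: (le_trans SE).
  have -> : q * (d / pi) * (q / pi) = q ^+ 2 * (d / pi ^+ 2) by rewrite -exprVn; ring.
  by rewrite ler_pM2l ?exprn_gt0// ler_pdivlMr ?exprn_gt0// mulrC.
rewrite /dissipation_rate /drift_cost E4E -/B -/q.
have -> : - (tau / 2 - (B + q) / pi) * d = B * (d / pi) + q * (d / pi) - tau / 2 * d by ring.
have -> : q / pi * d = q * (d / pi) by ring.
by move: e1 e2; clear; lra.
Qed.

End Dissipation.

(** * Differentiating the energy in time *)

Section TimeDerivative.
Context {R : realType}.
Implicit Types (f p : R -> R) (u : R -> R -> R) (t x : R).

Lemma cvge0_near {T : Type} {F : set_system T} {FF : Filter F} (f : T -> \bar R)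
    (e : R) : 0 < e -> f x @[x --> F] --> 0%E ->
  \forall x \near F, (f x <= e%:E)%E.
Proof.
move=> e0 /fine_cvgP[ffin /cvgr0_norm_le/(_ e e0) fe].
near=> x.
have fx : f x \is a fin_num by near: x.
rewrite -(fineK fx) lee_fin; apply: (le_trans (ler_norm _)).
by near: x.
Unshelve. all: by end_near. Qed.

(** The first summand of the norm is the uniform norm. *)
Lemma C2norm_ge f x : (`|f x|%:E <= C2norm f)%E.
Proof.
have sup0 i : (0 <= ereal_sup [set `|derive1n i f x|%:E | x in [set: R]])%E.
  by apply: (@le_trans _ _ `|derive1n i f 0|%:E); [rewrite lee_fin|apply: ereal_sup_ubound;
    exists 0].
rewrite /C2norm big_ord_recl /=; apply: (@le_trans _ _ (ereal_sup [set `|derive1n 0 f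
  x|%:E | x in [set: R]])).
  by apply: ereal_sup_ubound; exists x.
rewrite leeDl//; apply: sume_ge0 => i _. exact: (sup0 i.+1).
Qed.

Lemma continuous_bounded01 f : continuous f ->
  exists2 B : R, 0 < B & forall x, 0 <= x <= 1 -> `|f x| <= B.
Proof.
move=> cf.
have [c _ cmax] : exists2 c, c \in `[0, 1]%R & forall t, t \in `[0, 1]%R -> `|f t| <= `|f c|.
  by apply: EVT_max => //; apply: continuous_subspaceT; exact: cont_norm.
exists (`|f c| + 1) => [|x x01]; first by rewrite ltr_wpDl.
by rewrite (le_trans (cmax x _)) ?in_itv// lerDl.
Qed.

(** The difference quotient of the square is [2 psi Q + h Q^2], where [psi = u t - p]
    and [Q] is the difference quotient of [u]; as [Q] converges to [du] uniformly,
    so does this expression to [2 psi du]. *)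
Lemma is_derive_sqdist u du p t :
  continuous p -> continuous (u t) -> continuous du ->
  (\forall h \near 0^', continuous (u (t + h))) ->
  (forall e : R, 0 < e -> \forall h \near 0^',
     forall x, `|h^-1 * (u (t + h) x - u t x) - du x| <= e) ->
  is_derive t 1 (fun s => sint 0 1 (fun x => (u s x - p x) ^+ 2))
    (2 * sint 0 1 (fun x => (u t x - p x) * du x)).
Proof.
move=> cp cu cdu cuh unif.
pose psi x := u t x - p x; have cpsi : continuous psi by exact: cont_sub.
have [A A0 psiA] := continuous_bounded01 cpsi.
have [B B0 duB] := continuous_bounded01 cdu.
set l := 2 * _.
suff lim : h^-1 *: (((fun s => sint 0 1 (fun x => (u s x - p x) ^+ 2)) \o shift t)
    (h *: 1) - sint 0 1 (fun x => psi x ^+ 2)) @[h --> 0^'] --> l.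
  by apply: DeriveDef; [apply/cvg_ex; exists l|exact: cvg_lim lim].
apply/cvgrPdist_le => e e0.
pose K := 2 * A + (B + 1) ^+ 2.
have K0 : 0 < K.
  exact: (addr_gt0 (mulr_gt0 (ltr0n _ 2) A0) (exprn_gt0 2 (addr_gt0 B0 ltr01))).
pose dl := Num.min 1 (e / K).
have dl0 : 0 < dl by rewrite lt_min ltr01 divr_gt0.
have := unif _ dl0 => unifd.
near=> h.
have hn0 : h != 0 by near: h; exact: nbhs_dnbhs_neq.
have hd : `|h| <= dl by near: h; exact: dnbhs0_le.
have ch : continuous (u (t + h)) by near: h.
have uh : forall x, `|h^-1 * (u (t + h) x - u t x) - du x| <= dl by near: h.
rewrite /= [h%:A]mulr1 [h + t]addrC /GRing.scale/=.
pose Q x := h^-1 * (u (t + h) x - u t x).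
have cQ : continuous Q by apply: cont_mul; [exact: cont_cst|exact: cont_sub].
have lpsi2 := continuous_locint (cont_sqr cpsi).
have cw : continuous (fun x => u (t + h) x - p x) by exact: cont_sub.
have lw2 := continuous_locint (cont_sqr cw).
have lpd := continuous_locint (cont_mul cpsi cdu).
have -> : l - h^-1 * (sint 0 1 (fun x => (u (t + h) x - p x) ^+ 2) - sint 0 1 (fun x =>
  psi x ^+ 2)) =
    - sint 0 1 (fun x => 2 * psi x * (Q x - du x) + h * Q x ^+ 2).
  rewrite -(sintB _ _ lw2 lpsi2) -sintZ; last exact: locintB.
  rewrite /l -(sintZ _ _ 2 lpd) -sintB; [|exact: locintZ|by apply: locintZ; exact: locintB].
  rewrite -mulN1r -sintZ; last first.
    apply: continuous_locint; apply: cont_add.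
      by apply: cont_mul; [apply: cont_mul => //; exact: cont_cst|exact: cont_sub].
    by apply: cont_mul; [exact: cont_cst|exact: cont_sqr].
  apply: eq_sint => x _; rewrite /Q /psi.
  by move: (u (t + h) x) (u t x) (p x) (du x) hn0 => a b c d; clear=> hn0; field.
rewrite normrN.
have cg : continuous (fun x => 2 * psi x * (Q x - du x) + h * Q x ^+ 2).
  apply: cont_add.
    by apply: cont_mul; [apply: cont_mul => //; exact: cont_cst|exact: cont_sub].
  by apply: cont_mul; [exact: cont_cst|exact: cont_sqr].
apply: (le_trans (ler_norm_sint _ _ (continuous_locint cg))).
have dlK : dl * K <= e.
  by rewrite -ler_pdivlMr// ge_min lexx orbT.
apply: (le_trans _ dlK).
have -> : dl * K = sint 0 1 (fun _ : R => dl * K) by rewrite sint_cst// subr0 mulr1.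
apply: le_sint.
- exact/locint_norm/continuous_locint.
- exact/continuous_locint/cont_cst.
move=> x x01; have pA := psiA x x01; have dB := duB x x01; have Qd := uh x.
have dl1 : dl <= 1 by rewrite ge_min lexx.
have QB : `|Q x| <= B + 1.
  rewrite -(subrK (du x) (Q x)); apply: (le_trans (ler_normD _ _)).
  rewrite [leLHS]addrC; exact: (lerD dB (le_trans Qd dl1)).
apply: (le_trans (ler_normD _ _)); rewrite /K [leRHS]mulrDr; apply: lerD.
  rewrite !normrM (ger0_norm (ler0n _ 2)) mulrC; apply: ler_pM => //.
  by rewrite ler_pM2l ?ltr0n.
rewrite normrM; apply: ler_pM => //.
by rewrite normrX lerXn2r ?nnegrE ?normr_ge0// addr_ge0// ltW.
Unshelve. all: by end_near. Qed.

(** The function [e t * exp (lam t)] is nonincreasing. *)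
Lemma gronwall_exp_decay (e de : R -> R) (lam : R) :
  (forall t, 0 < t -> is_derive t 1 e (de t)) ->
  (forall t, 0 < t -> de t <= - lam * e t) ->
  forall s t, 0 < s -> s <= t -> e t <= e s * expR (- (lam * (t - s))).
Proof.
move=> dE ineq s t s0 st.
pose k x := e x * expR (lam * x + 0).
have dk x : 0 < x -> is_derive x 1 k (de x * expR (lam * x + 0) + e x * (expR (lam * x
  + 0) * lam)).
  move=> x0; apply: is_derive_mul; first exact: dE.
  by apply: is_derive_affine; exact: is_derive_expR.
have : k t <= k s.
  apply: (@ler0_derive1_nincr _ k s t).
  - by move=> x; rewrite in_itv/= => /andP[sx _];
      exact: (is_derive_derivable (dk x (lt_trans s0 sx))).
  - move=> x; rewrite in_itv/= => /andP[sx _]; have x0 := lt_trans s0 sx.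
    rewrite (is_derive_derive1 (dk x x0)).
    have := ineq x x0; rewrite -(ler_pM2r (expR_gt0 (lam * x + 0))); lra.
  - apply: derivable_within_continuous => x; rewrite in_itv/= => /andP[sx _].
    exact: (is_derive_derivable (dk x (lt_le_trans s0 sx))).
  - by [].
  - exact: st.
  - by [].
rewrite /k !addr0 => H.
rewrite mulrBr opprB expRB mulrA ler_pdivlMr ?expR_gt0//.
Qed.

End TimeDerivative.

(** * Square integrable functions and densities *)

Section Densities.
Context {R : realType}.
Local Notation mu := (@lebesgue_measure R).
Implicit Types (f g : R -> R) (a b x : R).

Lemma L2norm_sint f : locint (fun x => f x ^+ 2) ->
  L2norm f = (Num.sqrt (sint (-1) 1 (fun x => f x ^+ 2)))%:E.
Proof.
move=> lf; rewrite /L2norm unlock.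
have -> : (\int[mu]_x `|((EFin \o f) \_ (`[(-1)%R, 1%R]%classic : set R)) x| `^ 2 =
    (sint (-1) 1 (fun x => f x ^+ 2))%:E)%E.
  rewrite sintE /Rintegral fineK; last exact: (integrable_fin_num _ (lf (-1) 1)).
  rewrite [RHS]integral_mkcond; apply: eq_integral => x _.
  rewrite !patchE; case: ifP => _ /=.
    by rewrite powR_mulrn// real_normK ?num_real.
  by rewrite normr0 powR0.
rewrite poweR12_sqrt//; rewrite lee_fin; apply: sint_ge0 => x _; exact: sqr_ge0.
Qed.

(** Integrability of [f] follows from [|f| <= f^2 + 1]. *)
Lemma L2loc_locint f : L2loc f -> locint f /\ locint (fun x => f x ^+ 2).
Proof.
move=> [mf [mf2 _ f2]].
have l2 : locint (fun x => f x ^+ 2).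
  move=> a b; apply/integrableP; split.
    by apply/measurable_EFinP; exact: measurable_funTS.
  exact: (f2 `[a, b]%classic (@subsetT _ _) (@segment_compact _ _ _)).
split => // a b.
have l3 : locint (fun x => f x ^+ 2 + 1).
  by apply: locintD => //; exact/continuous_locint/cont_cst.
apply: (le_integrable _ _ _ (l3 a b)) => //.
  by apply/measurable_EFinP; exact: measurable_funTS.
move=> x _ /=; rewrite lee_fin [leRHS]ger0_norm; last by rewrite addr_ge0 ?sqr_ge0.
have := sqr_ge0 (`|f x| - 1); rewrite sqrrB real_normK ?num_real//.
have := normr_ge0 (f x); lra.
Qed.

Lemma even_periodic_rep f x : even_periodic f ->
  exists2 y, -1 <= y <= 1 & f x = f y.
Proof.
move=> [ef pf]; pose n := Num.truncn ((`|x| + 1) / 2).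
exists (`|x| - 2 *+ n).
  have h0 : 0 <= (`|x| + 1) / 2 by rewrite divr_ge0// addr_ge0.
  have h1 : (`|x| + 1) / 2 < n%:R + 1 by rewrite natr1; exact: truncnS_gt.
  have h2 : n%:R <= (`|x| + 1) / 2 by rewrite truncn_le.
  rewrite -[2 *+ n]mulr_natr; clear -h1 h2.
  by move: (n%:R : R) h1 h2 => m h1 h2; apply/andP; split; lra.
have -> : f x = f `|x| by case: (ger0P x) => // _; rewrite ef.
by rewrite -[RHS](periodicn pf n) subrK.
Qed.

Lemma Pe_density f : locint f -> even_periodic f -> Pe f -> density f.
Proof.
move=> lf epf [f0 _ _ f1]; split => //.
by move=> x; have [y y1 ->] := even_periodic_rep x epf; exact: f0.
Qed.

Lemma density_Pe f : density f -> Pe f.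
Proof. by move=> [lf [ef pf] f0 f1]; split. Qed.

Lemma derivable_is_derive f x : derivable f x 1 -> is_derive x 1 f (derive1 f x).
Proof. by move=> df; split => //; rewrite derive1E. Qed.

Lemma derivable_cont f : (forall x, derivable f x 1) -> continuous f.
Proof. by move=> df; exact: (is_derive_cont (fun x => derivable_is_derive (df x))). Qed.

Lemma locint_sqr_sub f g : L2loc f -> continuous g ->
  locint (fun x => (f x - g x) ^+ 2).
Proof.
move=> /L2loc_locint[lf lf2] cg; have lg2 := continuous_locint (cont_sqr cg).
rewrite (_ : (fun x => _) = (fun x => f x ^+ 2 - (2 * g x * f x) + g x ^+ 2)).
  apply: locintD => //; apply: locintB => //; apply: locint_mulcont => //.
  by apply: cont_mul => //; exact: cont_cst.
by apply/funext => x; ring.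
Qed.

Lemma sint_sqr_add a b f g : locint (fun x => f x ^+ 2) ->
  locint (fun x => g x ^+ 2) -> locint (fun x => (f x + g x) ^+ 2) ->
  sint a b (fun x => (f x + g x) ^+ 2) <=
  2 * sint a b (fun x => f x ^+ 2) + 2 * sint a b (fun x => g x ^+ 2).
Proof.
move=> lf2 lg2 lfg; rewrite -!sintZ// -sintD; [|exact: locintZ..].
apply: le_sint => //; first by apply: locintD; exact: locintZ.
by move=> x _; have := sqr_ge0 (f x - g x); lra.
Qed.

(** The increments are integrals of the derivative; Cauchy-Schwarz against the
    constant [1]. *)
Lemma oscillation_le f g a b : (forall x, is_derive x 1 f (g x)) -> continuous g ->
  0 <= a <= 1 -> 0 <= b <= 1 ->
  `|f b - f a| <= Num.sqrt (sint 0 1 (fun x => g x ^+ 2)).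
Proof.
move=> df cg a01 b01; wlog ab : a b a01 b01 / a <= b.
  by move=> H; case: (leP a b) => [/H->//|/ltW/H]; rewrite distrC; exact.
have lg := continuous_locint cg.
rewrite -(sint_derive df cg ab); apply: (le_trans (ler_norm_sint _ _ lg)).
move: a01 b01 => /andP[a0 _] /andP[_ b1].
have lng := locint_norm lg.
have n0 (x : R) : 0 <= `|g x| by exact: normr_ge0.
apply: (le_trans (le_sint_subset lng n0 a0 ab b1)).
have s0 : 0 <= sint 0 1 (fun x => `|g x|) by apply: sint_ge0 => x _.
rewrite -[leLHS](ger0_norm s0) -sqrtr_sqr; apply: ler_wsqrtr.
have := sint_cauchy_schwarz 0 1 (cont_norm cg) (@cont_cst R 1).
rewrite (@eq_sint _ _ _ _ (fun x => `|g x|)) => [|x _]; last by rewrite mulr1.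
rewrite [sint 0 1 (fun _ => 1 ^+ 2)](sint_cst _ ler01) expr1n subr0 !mulr1.
congr (_ <= _); apply: eq_sint => x _; by rewrite real_normK ?num_real.
Qed.

End Densities.

(** * Convergence of the solution *)

Section Evolution.
Context {R : realType}.
Context (r M sigma : R) (rho_0 rho_r G : R -> R) (u : R -> R -> R).
Context (r0 : 0 < r) (M0 : 0 <= M) (sigma0 : 0 < sigma).
Context (df : density rho_r) (rho0_L2 : L2loc rho_0).
Context (abv : noise_dominates r M (sigma ^+ 2)) (sol : solution r M sigma rho_0 rho_r u).
Context (oG : odd_periodic G)
  (GE : forall x, drift r M rho_r (gibbs (sigma ^+ 2) G) x = G x).
Implicit Types (t s x : R).

Let tau := sigma ^+ 2.
Let p := gibbs tau G.
Let dp x := - (2 / tau * G x) * p x.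
Let energy t := sint 0 1 (fun x => (u t x - p x) ^+ 2).
Let denergy t := sint 0 1 (fun x => (derive1 (u t) x - dp x) ^+ 2).
Let kap := dissipation_rate r M tau.

Let tau0 : 0 < tau. Proof. exact: exprn_gt0. Qed.
Let kap0 : 0 < kap. Proof. exact: dissipation_rate_gt0. Qed.
Let cG : continuous G. Proof. by case: oG. Qed.
Let dpE x : is_derive x 1 p (dp x). Proof. exact: is_derive_gibbs. Qed.
Let cp : continuous p. Proof. exact: is_derive_cont dpE. Qed.
Let cdp : continuous dp.
Proof.
apply: cont_mul => //; apply: cont_opp.
by apply: cont_mul => //; exact: cont_cst.
Qed.
Let dens_p : density p. Proof. exact: density_gibbs. Qed.

Lemma solution_C2ep t : 0 < t -> C2ep (u t).
Proof. by case: sol => -[C _] _ _ _ _; exact: C. Qed.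

Lemma solution_continuous t : 0 < t -> continuous (u t).
Proof. by move=> /solution_C2ep[_ d _ _]; exact: derivable_cont. Qed.

Lemma solution_density t : 0 < t -> density (u t).
Proof.
move=> t0; have [ep _ _ _] := solution_C2ep t0.
apply: Pe_density => //; first exact/continuous_locint/solution_continuous.
by case: sol => _ + _ _ _; apply; exact: ltW.
Qed.

(** The pointwise time derivative in the equation is the derivative in the [C^2]
    norm, which makes it continuous in space. *)
Lemma solution_velocity : exists du : R -> R -> R, forall t, 0 < t ->
  [/\ continuous (du t),
      forall e : R, 0 < e -> \forall h \near 0^',
        forall x, `|h^-1 * (u (t + h) x - u t x) - du t x| <= e &
      forall x, derivable (flux r M rho_r (u t)) x 1 /\
        du t x = derive1 (flux r M rho_r (u t)) x + tau / 2 * derive1n 2 (u t) x].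
Proof.
have [[_ [du duP]] _ pde _ _] := sol.
exists du => t t0; have [Cdu cvu _] := duP t t0.
have unif (e : R) : 0 < e -> \forall h \near 0^',
    forall x, `|h^-1 * (u (t + h) x - u t x) - du t x| <= e.
  move=> e0; apply: filterS (cvge0_near e0 cvu) => h hC x.
  rewrite -lee_fin; apply: le_trans hC.
  exact: (C2norm_ge (fun x => h^-1 * (u (t + h) x - u t x) - du t x)).
split => //; first by case: Cdu => _ d _ _; exact: derivable_cont.
move=> x; have [dfl <-] := pde t x t0; split => //.
rewrite /derive1; apply/esym/cvg_lim => //; apply/cvgrPdist_le => e e0.
apply: filterS (unif e e0) => h /(_ x).
by rewrite distrC [h + t]addrC.
Qed.

(** At each time the velocity is the derivative of the total flux, so the spatial
    dissipation inequality applies to it. *)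
Lemma energy_dissipation : exists de : R -> R, forall t, 0 < t ->
  [/\ is_derive t 1 energy (de t), de t <= - (2 * kap) * denergy t &
      pi ^+ 2 * energy t <= denergy t].
Proof.
have [du duP] := solution_velocity.
exists (fun t => 2 * sint 0 1 (fun x => (u t x - p x) * du t x)) => t t0.
have [cdu unif pde] := duP t t0.
have eD : is_derive t 1 energy (2 * sint 0 1 (fun x => (u t x - p x) * du t x)).
  apply: (is_derive_sqdist (du := du t)) => //; first exact: solution_continuous.
  near=> h; apply: solution_continuous.
  have : `|h| < t by near: h; exact: dnbhs0_lt.
  by rewrite ltr_norml => /andP[h1 _]; rewrite -ltrBlDl sub0r.
have [_ du1 du2 _] := solution_C2ep t0.
have flE x : is_derive x 1 (fun y => flux r M rho_r (u t) y + tau / 2 * derive1 (u t)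
  y) (du t x).
  have [dfl E] := pde x.
  have d1 := is_derive_add (derivable_is_derive dfl)
    (is_derive_scale (tau / 2) (derivable_is_derive (du2 x))).
  by apply: is_derive_eq d1 _; rewrite E.
have dd x := derivable_is_derive (du1 x).
have cdd := derivable_cont du2.
have [H1 H2] := dissipation r0 M0 tau0 df oG GE (solution_density t0) dd cdd flE cdu.
split => //.
by move: H1; rewrite -/kap -/p -/(denergy t); lra.
Unshelve. all: by end_near. Qed.

Lemma energy_decay s t : 0 < s -> s <= t ->
  energy t <= energy s * expR (- (2 * kap * pi ^+ 2 * (t - s))).
Proof.
have [de deP] := energy_dissipation.
apply: (gronwall_exp_decay (de := de)) => x x0; have [? H1 H2] := deP x x0 => //.
apply: (le_trans H1); rewrite !mulNr lerN2 -[leLHS]mulrA.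
exact: (ler_wpM2l (ltW (mulr_gt0 (ltr0n _ 2) kap0)) H2).
Qed.

(** The initial datum is attained in [L^2], which bounds the energy near time
    zero although the time derivative may blow up there. *)
Lemma energy_bounded_near0 : exists C dl : R,
  [/\ 0 <= C, 0 < dl & forall s, 0 < s -> s < dl -> energy s <= C].
Proof.
have [_ _ _ u0 L2c] := sol.
have l0 := locint_sqr_sub rho0_L2 cp.
have near_u0 : \forall s \near within `[0, +oo[ (nbhs (0 : R)),
    (L2norm (fun x => (u s x - u 0 x)%R) <= 1%:E)%E.
  by apply: cvge0_near (L2c 0 (lexx 0)).
rewrite near_withinE in near_u0.
have [dl /= dl0 near0] := (nbhs_ballP _ _).1 near_u0.
pose C0 := sint (-1) 1 (fun x => (rho_0 x - p x) ^+ 2).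
exists (1 + C0), dl; split => //.
  by rewrite addr_ge0//; apply: sint_ge0 => x _; exact: sqr_ge0.
move=> s s0 sdl.
have cu := solution_continuous s0; have [_ [eu pu] _ _] := solution_density s0.
have [_ [ep pp] _ _] := dens_p.
have lus : locint (fun x => (u s x - u 0 x) ^+ 2).
  rewrite (_ : (fun x => _) = (fun x => (rho_0 x - u s x) ^+ 2)); first exact: locint_sqr_sub.
  by apply/funext => x; rewrite u0 -sqrrN opprB.
have lup := continuous_locint (cont_sqr (cont_sub cu cp)).
have close : sint (-1) 1 (fun x => (u s x - u 0 x) ^+ 2) <= 1.
  have := near0 s; rewrite /ball/= sub0r normrN gtr0_norm// in_itv/= (ltW s0).
  move=> /(_ sdl isT); rewrite L2norm_sint// lee_fin => h.
  rewrite -[leLHS]sqr_sqrtr; last by apply: sint_ge0 => x _; exact: sqr_ge0.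
  by rewrite expr_le1// sqrtr_ge0.
have E2 : sint (-1) 1 (fun x => (u s x - p x) ^+ 2) = 2 * energy s.
  have even2 x : (u s (- x) - p (- x)) ^+ 2 = (u s x - p x) ^+ 2 by rewrite eu ep.
  exact: (sint_even lup even2).
have split_u : (fun x => (u s x - u 0 x + (rho_0 x - p x)) ^+ 2) = (fun x => (u s x - p
  x) ^+ 2).
  by apply/funext => x; rewrite u0; congr (_ ^+ 2); ring.
have := @sint_sqr_add _ (-1) 1 (fun x => u s x - u 0 x) (fun x => rho_0 x - p x) lus l0.
rewrite split_u => /(_ lup); rewrite E2 -/C0; lra.
Qed.

Lemma L2norm_energy t : 0 < t ->
  L2norm (fun x => u t x - p x) = (Num.sqrt (2 * energy t))%:E.
Proof.
move=> t0; have cu := solution_continuous t0; have [_ [eu pu] _ _] := solution_density t0.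
have [_ [ep pp] _ _] := dens_p.
have lup := continuous_locint (cont_sqr (cont_sub cu cp)).
rewrite L2norm_sint//; congr (Num.sqrt _)%:E.
have even2 x : (u t (- x) - p (- x)) ^+ 2 = (u t x - p x) ^+ 2 by rewrite eu ep.
exact: (sint_even lup even2).
Qed.

(** The energy decays from some time close to [0] at which it is bounded; time
    [0] itself, where the equation is not available, is treated separately. *)
Lemma L2_decay : exists beta lambda : R,
  [/\ 0 < beta, 0 < lambda & forall t, 0 <= t ->
     (L2norm (fun x => (u t x - p x)%R) <= (beta * expR (- (lambda * t)))%:E)%E].
Proof.
have [C [dl [C0 dl0 bound]]] := energy_bounded_near0.
pose lam := kap * pi ^+ 2.
have lam0 : 0 < lam by rewrite mulr_gt0// exprn_gt0// pi_gt0.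
pose D := 2 * (C * expR (2 * lam * dl)).
pose n0 := Num.sqrt (sint (-1) 1 (fun x => (rho_0 x - p x) ^+ 2)).
exists (Num.sqrt D + n0 + 1), lam.
have n00 : 0 <= n0 by exact: sqrtr_ge0.
have sD0 : 0 <= Num.sqrt D by exact: sqrtr_ge0.
split => //; first by lra.
move=> t; rewrite le_eqVlt => /predU1P[<-|t0].
  have u0 : u 0 = rho_0 by case: sol => _ _ _ u0 _; apply/funext.
  rewrite u0 L2norm_sint; last exact: locint_sqr_sub.
  by rewrite -/n0 mulr0 oppr0 expR0 mulr1 lee_fin; lra.
rewrite L2norm_energy// lee_fin.
pose s := Num.min t (dl / 2).
have s0 : 0 < s by rewrite lt_min t0 divr_gt0.
have st : s <= t by rewrite ge_min lexx.
have sdl : s < dl.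
  have s2 : s <= dl / 2 by rewrite ge_min lexx orbT.
  by apply: (le_lt_trans s2); lra.
have Es := bound s s0 sdl.
have Et : energy t <= C * expR (2 * lam * dl) * expR (- (lam * t)) ^+ 2.
  apply: (le_trans (energy_decay s0 st)).
  rewrite -[leRHS]mulrA -expRM_natl -expRD; apply: ler_pM; rewrite ?expR_ge0//.
    by apply: sint_ge0 => x _; exact: sqr_ge0.
  rewrite ler_expR -[2 * kap * _]mulrA -/lam.
  have : lam * s <= lam * dl by rewrite ler_pM2l// ltW.
  lra.
apply: (@le_trans _ _ (Num.sqrt (D * expR (- (lam * t)) ^+ 2))).
  by apply: ler_wsqrtr; rewrite /D -mulrA ler_pM2l.
have D0 : 0 <= D by rewrite mulr_ge0// mulr_ge0// expR_ge0.
rewrite sqrtrM// sqrtr_sqr ger0_norm ?expR_ge0// ler_wpM2r ?expR_ge0//.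
lra.
Qed.

(** The total dissipation is finite, so the gradient of the perturbation is
    small at some time; there the solution is uniformly close to the positive
    stationary state. *)
Lemma exists_positive_time : exists2 t, 0 < t & forall x, 0 < u t x.
Proof.
have [de deP] := energy_dissipation.
have GB x : `|G x| <= 2 * r * (1 + M).
  by rewrite -GE; exact: (@drift_bound _ r M rho_r p x (ltW r0) M0 df dens_p).
pose m := expR (- (2 * (2 * r * (1 + M)) / tau)).
have m0 : 0 < m by exact: expR_gt0.
have pm x : 0 <= x <= 1 -> m <= p x.
  by move=> x01; have /andP[] := gibbs_bounds tau0 cG GB x01.
pose c := 2 * kap * m ^+ 2.
have c0 : 0 < c by rewrite mulr_gt0 ?mulr_gt0// exprn_gt0.
have e1 : 0 <= energy 1 by apply: sint_ge0 => x _; exact: sqr_ge0.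
pose T := 1 + (energy 1 + 1) / c.
have T1 : 1 < T by rewrite ltrDl divr_gt0// ltr_wpDl.
have T0 : 0 <= energy T by apply: sint_ge0 => x _; exact: sqr_ge0.
(* On [1, T] the mean slope of the energy is above [- c]: otherwise the energy
   would become negative. *)
have [t t1T slope] : exists2 t, t \in `]1, T[%R & energy T - energy 1 = de t * (T - 1).
  apply: MVT => //.
    by move=> x; rewrite in_itv/= => /andP[x1 _]; case: (deP x (lt_trans ltr01 x1)).
  apply: derivable_within_continuous => x; rewrite in_itv/= => /andP[x1 _].
  by case: (deP x (lt_le_trans ltr01 x1)) => /is_derive_derivable.
have t0 : 0 < t by move: t1T; rewrite in_itv/= => /andP[/(lt_trans ltr01)].
have [_ dec _] := deP t t0.
have dsmall : denergy t < m ^+ 2.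
  have TE : c * (T - 1) = energy 1 + 1 by rewrite /T; field; exact: lt0r_neq0.
  have T10 : 0 < T - 1 by rewrite subr_gt0.
  have det : - c < de t.
    by rewrite -(ltr_pM2r T10) -slope mulNr TE; move: T0; lra.
  have k20 : 0 < 2 * kap by rewrite mulr_gt0.
  rewrite -(ltr_pM2l k20) -/c; move: det dec; rewrite mulNr; lra.
exists t => // x.
have [_ du1 du2 _] := solution_C2ep t0.
have dens_u := solution_density t0.
have [lu [eu pu] _ u1] := dens_u; have [lp _ _ p1] := dens_p.
pose psi y := u t y - p y.
have cu := solution_continuous t0.
have cpsi : continuous psi := cont_sub cu cp.
have dpsi (y : R) : is_derive y 1 psi (derive1 (u t) y - dp y).
  exact: (is_derive_sub (derivable_is_derive (du1 y)) (dpE y)).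
have cdpsi : continuous (fun y => derive1 (u t) y - dp y).
  exact: (cont_sub (derivable_cont du2) cdp).
pose eta := Num.sqrt (denergy t).
have etam : eta < m.
  have -> : m = Num.sqrt (m ^+ 2) by rewrite sqrtr_sqr gtr0_norm.
  by rewrite ltr_sqrt// exprn_gt0.
have lpsi := continuous_locint cpsi.
have pos y : 0 <= y <= 1 -> 0 < u t y.
  move=> y01.
  have cst (k : R) : sint 0 1 (fun _ => k) = k by rewrite sint_cst// subr0 mulr1.
  have : - eta <= psi y.
    have -> : - eta = sint 0 1 (fun z => psi z + - eta).
      rewrite sintD; [|exact: lpsi|exact/continuous_locint/cont_cst].
      by rewrite sintB// u1 p1 subrr add0r cst.
    rewrite -[leRHS]cst; apply: le_sint.
    - by apply: locintD => //; exact/continuous_locint/cont_cst.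
    - exact/continuous_locint/cont_cst.
    - move=> z z01; have osc := oscillation_le dpsi cdpsi y01 z01.
      by rewrite lerBlDr -lerBlDl; exact: (le_trans (ler_norm _) osc).
  rewrite lerBrDr addrC => etap.
  have pe : 0 < p y - eta by rewrite subr_gt0 (lt_le_trans etam (pm y y01)).
  exact: (lt_le_trans pe etap).
have [y /andP[y1 y2] ->] := even_periodic_rep x (conj eu pu).
have -> : u t y = u t `|y| by case: (ger0P y) => // _; rewrite eu.
by apply: pos; rewrite normr_ge0/= ler_norml y1 y2.
Qed.

(** At a time where the solution is positive, the drift is the quotient of the
    flux and the solution, hence continuously differentiable; the stationary
    drift differs from it by the convolution of a continuous function. *)
Lemma stationary_drift_C1 : exists2 dG : R -> R,
  continuous dG & forall x, is_derive x 1 G (dG x).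
Proof.
have [t t0 upos] := exists_positive_time.
have [du duP] := solution_velocity; have [cdu _ pde] := duP t t0.
have cu := solution_continuous t0; have [_ du1 du2 cu2] := solution_C2ep t0.
have u0 x : u t x != 0 by exact: lt0r_neq0.
have [lf _ _ _] := df.
pose fl := flux r M rho_r (u t).
have dfl x : is_derive x 1 fl (derive1 fl x).
  by apply: derivable_is_derive; case: (pde x).
have cdfl : continuous (derive1 fl).
  have -> : derive1 fl = fun x => du t x - tau / 2 * derive1n 2 (u t) x.
    by apply/funext => x; have [_ ->] := pde x; rewrite addrK.
  apply: (cont_sub cdu); apply: cont_mul; [exact: cont_cst|exact: cu2].
pose v y := p y - u t y.
have cv : continuous v := cont_sub cp cu.
have GE2 : G = fun x => fl x * (u t x)^-1 + conv_w r v x.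
  apply/funext => x; rewrite -[LHS]GE.
  have -> : fl x * (u t x)^-1 = drift r M rho_r (u t) x.
    by rewrite /fl /flux mulrAC mulfV ?mul1r.
  rewrite /v -(drift_diff r M x lf).
  - by rewrite addrC subrK.
  - exact: continuous_locint.
  - exact: continuous_locint.
exists (fun x => derive1 fl x * (u t x)^-1 + fl x * (- (u t x) ^- 2 * derive1 (u t) x) +
  conv_w_deriv r v x).
  have cinv := cont_inv u0 cu.
  have cfl := is_derive_cont dfl.
  have csq : continuous (fun x => - (u t x) ^- 2).
    rewrite (_ : (fun x => _) = (fun x => - (u t x)^-1 ^+ 2));
      first exact: (cont_opp (cont_sqr cinv)).
    by apply/funext => x; rewrite exprVn.
  have cu1 := derivable_cont du2.
  exact: (cont_add (cont_add (cont_mul cdfl cinv) (cont_mul cfl (cont_mul csq cu1)))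
    (continuous_conv_w_deriv cv)).
move=> x; rewrite GE2; apply: is_derive_add; last exact: (is_derive_conv_w x (ltW r0)).
apply: is_derive_mul => //.
exact: (is_deriveV (u0 x) (derivable_is_derive (du1 x))).
Qed.

(** The flux of [p] is a multiple of the derivative of [p]. *)
Lemma stationary_state : C2ep p /\ stationary r M sigma rho_r p.
Proof.
have [dG cdG dGE] := stationary_drift_C1.
have dpF : derive1 p = dp by apply/funext => x; exact: is_derive_derive1.
pose ddp x := - (2 / tau * dG x) * p x + - (2 / tau * G x) * dp x.
have ddpE x : is_derive x 1 dp (ddp x).
  apply: is_derive_mul => //; apply: is_deriveN; exact: is_derive_scale.
have ddpF : derive1 dp = ddp by apply/funext => x; exact: is_derive_derive1.
have dd2 : derive1n 2 p = ddp by rewrite /derive1n/= dpF ddpF.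
have [_ epp _ _] := dens_p.
split.
  split; [exact: epp| | |].
  - by move=> x; exact: (is_derive_derivable (dpE x)).
  - by move=> x; rewrite dpF; exact: (is_derive_derivable (ddpE x)).
  - have copp g : continuous g -> continuous (fun x => - (2 / tau * g x)).
      by move=> cg; exact: (cont_opp (cont_mul (@cont_cst R (2 / tau)) cg)).
    rewrite dd2.
    exact: (cont_add (cont_mul (copp _ cdG) cp) (cont_mul (copp _ cG) cdp)).
have flE : flux r M rho_r p = fun x => - (tau / 2) * dp x.
  apply/funext => x; rewrite /flux GE /dp; field; exact: lt0r_neq0.
move=> x; rewrite flE dd2.
have dfl := is_derive_scale (- (tau / 2)) (ddpE x).
split; first exact: is_derive_derivable dfl.
by rewrite (is_derive_derive1 dfl) mulNr subrr.
Qed.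

End Evolution.

Theorem theorem2p3 (R : realType) (r M : R) (r_gt0 : 0 < r) (M_ge0 : 0 <= M) :
  (exists! sigma_s : R, threshold r M sigma_s) /\
  forall (sigma sigma_s : R) (rho_0 rho_r : R -> R) (rho : R -> R -> R),
    0 < sigma ->
    Hep 3 rho_0 -> Pe rho_0 ->
    Hep 2 rho_r -> Pe rho_r ->
    solution r M sigma rho_0 rho_r rho ->
    threshold r M sigma_s -> sigma_s < sigma ->
    exists rho_s : R -> R,
      [/\ C2ep rho_s, Pe rho_s, stationary r M sigma rho_r rho_s &
          exists beta lambda : R,
            [/\ 0 < beta, 0 < lambda &
                forall t : R, 0 <= t ->
                  (L2norm (fun x => (rho t x - rho_s x)%R)
                     <= (beta * expR (- (lambda * t)))%:E)%E]].
Proof.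
have A0 : 0 < 4 * r * (3 + M) / pi.
  apply: divr_gt0; last exact: pi_gt0.
  exact: (mulr_gt0 (mulr_gt0 (ltr0n _ 4) r_gt0) (ltr_wpDr M_ge0 (ltr0n _ 3))).
have B0 : 0 < 4 * r ^+ 2 / (pi * Num.sqrt 3).
  apply: divr_gt0; first exact: (mulr_gt0 (ltr0n _ 4) (exprn_gt0 2 r_gt0)).
  by apply: mulr_gt0; [exact: pi_gt0|rewrite sqrtr_gt0 ltr0n].
have C0 : 0 < 8 * r * (1 + M).
  exact: (mulr_gt0 (mulr_gt0 (ltr0n _ 8) r_gt0) (ltr_wpDr M_ge0 ltr01)).
split; first exact: (threshold_exists_unique A0 B0 C0).
move=> sigma sigma_s rho_0 rho_r rho sigma0 [[rho0_L2 _] _] _ [[rhor_L2 _] ep_r] Pr sol.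
move=> [s0 sE] s_lt.
have abv : noise_dominates r M (sigma ^+ 2) := above_threshold A0 B0 C0 s0 sE s_lt.
have dens_r : density rho_r by apply: Pe_density => //; case: (L2loc_locint rhor_L2).
have [G oG GE] := stationary_drift r_gt0 M_ge0 (noise_dominates_2r r_gt0 M_ge0 abv) dens_r.
have [C2p stp] := stationary_state r_gt0 M_ge0 sigma0 dens_r abv sol oG GE.
exists (gibbs (sigma ^+ 2) G); split; [exact: C2p| |exact: stp|].
  exact: (density_Pe (density_gibbs (sigma ^+ 2) oG)).
exact: (L2_decay r_gt0 M_ge0 sigma0 dens_r rho0_L2 abv sol oG GE).
Qed.
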